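(* Let $J:\mathbb{R}^n\to[0,\infty)$ be convex, lower semicontinuous and absolutely one-homogeneous, and let $f\in\mathbb{R}^n$. The function $u_{VM}:[0,\infty)\to\mathbb{R}^n$ is Lipschitz continuous. Moreover, the spectral representation satisfies $\phi_{VM}\in\big(W^{1,1}_{loc}([0,\infty);\mathbb{R}^n)\big)^*$, i.e. $\phi_{VM}$ is a well-defined continuous linear functional on $W^{1,1}_{loc}([0,\infty);\mathbb{R}^n)$.
   Context: Absolutely one-homogeneous means $J(su)=|s|J(u)$ for all $s\in\mathbb{R}$, $u\in\mathbb{R}^n$. $\|\cdot\|$ is the Euclidean norm. For $t>0$, $u_{VM}(t)$ is the unique minimizer over $u\in\mathbb{R}^n$ of $\frac12\|u-f\|^2+tJ(u)$, and $u_{VM}(0)=f$; $u_{VM}(t)$ is constant for all large $t$. The spectral (wavelength) representation is $\phi_{VM}(t)=t\,\partial_{tt}u_{VM}(t)$ in the distributional sense, i.e. it acts on test functions $v$ by $$ v\mapsto -\int_0^\infty \big(t\,\partial_t v(t)+v(t)\big)\cdot\partial_t u_{VM}(t)\,dt. $$ $W^{1,1}_{loc}([0,\infty);\mathbb{R}^n)$ is the space of functions belonging to $W^{1,1}((0,T);\mathbb{R}^n)$ for every $T<\infty$, with the topology given by these seminorms. *)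

(* Defs.v *)
From HB Require Import structures.
From mathcomp Require Import all_boot all_order all_algebra.
From mathcomp Require Import all_classical all_reals all_analysis.

Set Implicit Arguments.
Unset Strict Implicit.
Unset Printing Implicit Defensive.

Import Order.TTheory GRing.Theory Num.Theory.
Import numFieldNormedType.Exports.

Local Open Scope classical_set_scope.
Local Open Scope ring_scope.

(* The library norm on 'rV[R]_n is the sup norm, so the Euclidean structure
   is introduced here. *)
Definition dot (R : realType) (n : nat) (u v : 'rV[R]_n) : R :=
  \sum_(i < n) u 0 i * v 0 i.

Definition enorm (R : realType) (n : nat) (u : 'rV[R]_n) : R :=
  Num.sqrt (dot u u).

Definition abs_one_homogeneous (R : realType) (n : nat) (J : 'rV[R]_n -> R) :=
  forall (s : R) (u : 'rV[R]_n), J (s *: u) = `|s| * J u.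

Definition VM_energy (R : realType) (n : nat) (J : 'rV[R]_n -> R)
    (f : 'rV[R]_n) (t : R) (u : 'rV[R]_n) : R :=
  2^-1 * enorm (u - f) ^+ 2 + t * J u.

(* For t > 0 the energy has exactly one minimizer when J is nonnegative,
   convex and lower semicontinuous; the default value f of xget is then never
   used. Values at t < 0 are irrelevant. *)
Definition uVM (R : realType) (n : nat) (J : 'rV[R]_n -> R) (f : 'rV[R]_n)
    (t : R) : 'rV[R]_n :=
  if 0 < t then
    xget f [set u | forall w, VM_energy J f t u <= VM_energy J f t w]
  else f.

Definition Cc_infty (R : realType) (Omega : set R) (phi : R -> R) :=
  (forall (k : nat) (x : R), derivable (derive1n k phi) x 1) /\
  exists K : set R,
    [/\ compact K, K `<=` Omega & forall x, ~ K x -> phi x = 0].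

(* Maps R -> 'rV[R]_n stand for functions defined on Omega only: their values
   outside Omega never matter. *)
Definition is_weak_derivative (R : realType) (n : nat) (Omega : set R)
    (v g : R -> 'rV[R]_n) :=
  forall i : 'I_n,
    [/\ locally_integrable Omega (fun t => v t 0 i),
        locally_integrable Omega (fun t => g t 0 i) &
        forall phi : R -> R, Cc_infty Omega phi ->
          \int[lebesgue_measure]_(t in Omega) (v t 0 i * derive1 phi t) =
          - \int[lebesgue_measure]_(t in Omega) (g t 0 i * phi t)].

(* A representative of the weak derivative, which is unique up to a.e.
   equality. *)
Definition weak_derivative (R : realType) (n : nat) (Omega : set R)
    (v : R -> 'rV[R]_n) : R -> 'rV[R]_n :=
  xget (fun _ => 0) [set g | is_weak_derivative Omega v g].

Definition L1 (R : realType) (n : nat) (Omega : set R) (v : R -> 'rV[R]_n) :=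
  forall i : 'I_n,
    lebesgue_measure.-integrable Omega (fun t => (v t 0 i)%:E).

Definition W11 (R : realType) (n : nat) (Omega : set R)
    (v : R -> 'rV[R]_n) :=
  L1 Omega v /\
  exists g, is_weak_derivative Omega v g /\ L1 Omega g.

Definition W11_norm (R : realType) (n : nat) (Omega : set R)
    (v : R -> 'rV[R]_n) : R :=
  \int[lebesgue_measure]_(t in Omega) enorm (v t) +
  \int[lebesgue_measure]_(t in Omega) enorm (weak_derivative Omega v t).

Definition W11loc (R : realType) (n : nat) : set (R -> 'rV[R]_n) :=
  [set v | forall T : R, 0 < T -> W11 `]0, T[ v].

(* Neighbourhoods of v for the topology given by the W11_norm `]0, T[, T > 0.
   These seminorms increase with T, so that their balls form a base and finite
   intersections are not needed. *)
Definition W11loc_nbhs (R : realType) (n : nat) (v : R -> 'rV[R]_n) :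
    set_system (R -> 'rV[R]_n) :=
  [set A | exists T eps : R, [/\ 0 < T, 0 < eps &
     [set w | W11loc w /\ W11_norm `]0, T[ (w - v) < eps] `<=` A]].

(* Phi is given on representatives; the first clause says that it factors
   through a.e. classes on the half-line. *)
Definition W11loc_dual (R : realType) (n : nat)
    (Phi : (R -> 'rV[R]_n) -> R) :=
  [/\ (forall v w : R -> 'rV[R]_n, W11loc v -> W11loc w ->
         {ae lebesgue_measure, forall t : R, 0 < t -> v t = w t} ->
         Phi v = Phi w),
      (forall (a : R) (v w : R -> 'rV[R]_n), W11loc v -> W11loc w ->
         Phi (a *: v + w) = a * Phi v + Phi w) &
      (forall v : R -> 'rV[R]_n, W11loc v -> Phi @ W11loc_nbhs v --> Phi v)].

(* (t v'(t) + v(t)) . u'(t), where u' and v' stand for weak derivatives *)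
Definition spectral_integrand (R : realType) (n : nat)
    (u' v v' : R -> 'rV[R]_n) (t : R) : R :=
  dot (t *: v' t + v t) (u' t).

Definition phiVM (R : realType) (n : nat) (J : 'rV[R]_n -> R) (f : 'rV[R]_n)
    (v : R -> 'rV[R]_n) : R :=
  - \int[lebesgue_measure]_(t in `]0, +oo[)
      spectral_integrand (weak_derivative `]0, +oo[ (uVM J f))
        v (weak_derivative `]0, +oo[ v) t.

(* Main.v *)
Require Import Defs.
From HB Require Import structures.
From mathcomp Require Import all_boot all_order all_algebra.
From mathcomp Require Import all_classical all_reals all_analysis.
From mathcomp Require Import measurable_realfun ring lra.

Import Order.TTheory GRing.Theory Num.Theory.
Import numFieldNormedType.Exports.

Local Open Scope classical_set_scope.
Local Open Scope ring_scope.

Set Implicit Arguments.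
Unset Strict Implicit.
Unset Printing Implicit Defensive.

(** A convex one-homogeneous function [J] is a seminorm, so that [uVM t] is the
    unique [u] for which [f - u] is [t] times a subgradient of [J] at [u]
    ([uVM_is_prox], [is_prox_uVM]). Monotonicity of the subdifferential together
    with the boundedness of subgradients makes [uVM] Lipschitz
    ([uVM_lipschitz]). For large [t] the path is constant, equal to the
    orthogonal projection of [f] on the kernel of [J], because [J] is bounded
    below by a multiple of the norm on the orthogonal complement of that kernel
    ([uVM_extinction]).

    A Lipschitz function [h] on the half-line has a bounded weak derivative. Up
    to a linear function and a scaling, [h] is a nondecreasing function whose
    Stieltjes measure is dominated by Lebesgue measure, and the Radon-Nikodym
    density of that measure has [h] as a primitive ([lipschitz_primitive]);
    Fubini's theorem then yields integration by parts against test functions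
    ([integral_primitive_test]). As [uVM] is eventually constant, its weak
    derivative [w] is bounded and vanishes outside some [`]0, T[].

    Weak derivatives are unique almost everywhere ([weak_derivative_unique]),
    by the lemma of du Bois-Reymond, which rests on the smooth bumps built from
    [exp(-1/x)]. Uniqueness makes the integral independent of the chosen
    representatives, and it allows the weak derivatives of [v] on the bounded
    intervals to be glued to one on the half-line ([W11loc_weak_derivative]).
    Finally [|(t v' + v) . w| <= C (|v| + |v'|)] on [`]0, T[] bounds the
    functional by [C] times the single seminorm attached to [`]0, T[]
    ([phiVM_bounded]); together with linearity this is continuity. *)

(** * Euclidean geometry *)

Lemma cvg_sumR {R : realType} {T : Type} {F : set_system T} {FF : Filter F} n
    (g : 'I_n -> T -> R) (a : 'I_n -> R) :
  (forall i, g i x @[x --> F] --> a i) ->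
  \sum_(i < n) g i x @[x --> F] --> \sum_(i < n) a i.
Proof. by move=> h; apply: cvg_big => // z; apply: cvgD; [exact: cvg_fst|exact: cvg_snd]. Qed.

Section euclidean.
Context {R : realType} {n : nat}.
Implicit Types u v w : 'rV[R]_n.

Lemma dotC u v : dot u v = dot v u.
Proof. by apply: eq_bigr => i _; rewrite mulrC. Qed.

Lemma dotDl u v w : dot (u + v) w = dot u w + dot v w.
Proof. by rewrite -big_split; apply: eq_bigr => i _; rewrite mxE mulrDl. Qed.

Lemma dotZl a u v : dot (a *: u) v = a * dot u v.
Proof. by rewrite /dot mulr_sumr; apply: eq_bigr => i _; rewrite mxE mulrA. Qed.

Lemma dotDr u v w : dot w (u + v) = dot w u + dot w v.
Proof. by rewrite !(dotC w) dotDl. Qed.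

Lemma dotZr a u v : dot u (a *: v) = a * dot u v.
Proof. by rewrite !(dotC u) dotZl. Qed.

Lemma dotNl u v : dot (- u) v = - dot u v.
Proof. by rewrite -scaleN1r dotZl mulN1r. Qed.

Lemma dotNr u v : dot u (- v) = - dot u v.
Proof. by rewrite !(dotC u) dotNl. Qed.

Definition dotE := (dotDl, dotDr, dotZl, dotZr, dotNl, dotNr).

Lemma dot_ge0 u : 0 <= dot u u.
Proof. by apply: sumr_ge0 => i _; rewrite -expr2 sqr_ge0. Qed.

Lemma enorm_sqr u : enorm u ^+ 2 = dot u u.
Proof. by rewrite /enorm sqr_sqrtr// dot_ge0. Qed.

Lemma enorm_ge0 u : 0 <= enorm u.
Proof. exact: sqrtr_ge0. Qed.

Lemma coord_le_enorm u i : `|u 0 i| <= enorm u.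
Proof.
rewrite -(@ler_pXn2r _ 2)// ?nnegrE ?enorm_ge0// enorm_sqr real_normK ?num_real//.
rewrite /dot (bigD1 i)//= -expr2 lerDl.
by apply: sumr_ge0 => j _; rewrite -expr2 sqr_ge0.
Qed.

Lemma enorm_le_sum u : enorm u <= \sum_(i < n) `|u 0 i|.
Proof.
have s0 : 0 <= \sum_(i < n) `|u 0 i| by exact: sumr_ge0.
rewrite -(@ler_pXn2r _ 2)// ?nnegrE ?enorm_ge0// enorm_sqr.
rewrite [leRHS]expr2 mulr_suml; apply: ler_sum => i _.
rewrite (le_trans (ler_norm _))// normrM ler_wpM2l//.
by rewrite (bigD1 i)//= lerDl sumr_ge0.
Qed.

Lemma enorm_eq0 u : (enorm u == 0) = (u == 0).
Proof.
apply/eqP/eqP => [u0|->]; last first.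
  by apply/eqP; rewrite -sqrf_eq0 enorm_sqr /dot big1// => i _; rewrite mxE mul0r.
apply/rowP => i; rewrite mxE; apply/eqP; rewrite -normr_le0 -u0.
exact: coord_le_enorm.
Qed.

Lemma enormZ a u : enorm (a *: u) = `|a| * enorm u.
Proof.
apply/eqP; rewrite -(@eqrXn2 _ 2)// ?mulr_ge0 ?enorm_ge0//.
by rewrite exprMn !enorm_sqr !dotE real_normK ?num_real//; apply/eqP; ring.
Qed.

Lemma cauchy_schwarz u v : `|dot u v| <= enorm u * enorm v.
Proof.
rewrite -(@ler_pXn2r _ 2)// ?nnegrE ?mulr_ge0 ?enorm_ge0//.
rewrite exprMn !enorm_sqr real_normK ?num_real//.
have [->|v0] := eqVneq v 0.
  by rewrite -(scale0r 0) !dotZr !mul0r mulr0 expr0n.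
have vv : 0 < dot v v by rewrite -enorm_sqr exprn_gt0// lt0r enorm_eq0 v0 enorm_ge0.
have := dot_ge0 (dot v v *: u - dot u v *: v).
rewrite !dotE (dotC v u) => h.
rewrite -subr_ge0 -(pmulr_rge0 _ vv); apply: le_trans h _.
by rewrite le_eqVlt; apply/orP; left; apply/eqP; ring.
Qed.

Lemma continuous_dot : continuous (fun u => dot u u).
Proof.
move=> u; rewrite /continuous_at /dot.
apply: (@cvg_sumR _ _ (nbhs u)) => i.
by apply: cvgM; exact: coord_continuous.
Qed.

Lemma continuous_enorm : continuous (@enorm R n).
Proof. by move=> u; apply: continuous_comp; [exact: continuous_dot|exact: sqrt_continuous]. Qed.

Lemma closed_coord_bounded_compact (A : set 'rV[R]_n) M :
  closed A -> (forall u i, A u -> `|u 0 i| <= M) -> compact A.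
Proof.
move=> cA AM.
apply: (subclosed_compact cA (rV_compact (fun=> @segment_compact _ (- M) M))) => u Au i.
by rewrite /= in_itv/= -ler_norml AM.
Qed.

(** Sublevel sets of the energy are bounded because of the quadratic term and
    closed by continuity, hence compact. *)
Lemma proximal_exists (A : set 'rV[R]_n) (H : 'rV[R]_n -> R) f :
  closed A -> A !=set0 -> continuous H -> (forall u, 0 <= H u) ->
  exists2 u, A u & forall w, A w ->
    2^-1 * enorm (u - f) ^+ 2 + H u <= 2^-1 * enorm (w - f) ^+ 2 + H w.
Proof.
move=> cA [a Aa] cH H0; pose E u := 2^-1 * enorm (u - f) ^+ 2 + H u.
have cE : continuous E.
  move=> u; apply: (@cvgD _ _ _ (nbhs u)); last exact: cH.
  apply: cvgMl_tmp.
  rewrite (_ : (fun _ => _) = (fun u => dot u u) \o (fun u => u - f)); last first.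
    by apply/funext => w; rewrite /= enorm_sqr.
  rewrite /= enorm_sqr.
  apply: (@continuous_comp _ _ _ (fun u => u - f) (fun u => dot u u)).
    by apply: (@cvgB _ _ _ (nbhs u)); [exact: cvg_id|exact: cvg_cst].
  exact: continuous_dot.
pose B := A `&` [set u | E u <= E a].
have cB : closed B.
  apply: closedI => //.
  exact: (continuous_closedP E).1 cE _ (@closed_le R (E a)).
have E0 u : 0 <= E u by rewrite addr_ge0// mulr_ge0// ?invr_ge0// sqr_ge0.
have bB : compact B.
  apply: (@closed_coord_bounded_compact _ (1 + 2 * E a + \sum_(i < n) `|f 0 i|)) => // u i [_ Eu].
  have Eq : 2^-1 * enorm (u - f) ^+ 2 <= E a by apply: le_trans Eu; rewrite lerDl.
  have e1 : enorm (u - f) <= 1 + 2 * E a.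
    have := enorm_ge0 (u - f); have := E0 a.
    move: (enorm (u - f)) Eq => x; nra.
  have e2 := coord_le_enorm (u - f) i; rewrite !mxE in e2.
  have e3 : `|f 0 i| <= \sum_(i < n) `|f 0 i| by rewrite (bigD1 i)//= lerDl sumr_ge0.
  have e4 : `|u 0 i| <= `|u 0 i - f 0 i| + `|f 0 i|.
    by rewrite -{1}(subrK (f 0 i) (u 0 i)) ler_normD.
  lra.
have B0 : B !=set0 by exists a; split => //=.
have [u /set_mem[Au Eu] umin] := EVT_min_rV B0 bB (continuous_subspaceT cE).
exists u => // w Aw; have [wa|wa] := leP (E w) (E a).
  by apply: umin; apply/mem_set; split.
by rewrite -/(E u) -/(E w) (le_trans Eu)// ltW.
Qed.

End euclidean.

(** * The path of proximal points of a seminorm *)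

Section seminorm.
Context {R : realType} {n : nat} (J : 'rV[R]_n -> R).
Hypothesis J_ge0 : forall u, 0 <= J u.
Hypothesis J_convex : convex_function [set: 'rV[R]_n] J.
Hypothesis J_hom : abs_one_homogeneous J.
Implicit Types (u v w f : 'rV[R]_n).

Lemma hom0 : J 0 = 0.
Proof. by rewrite -(scale0r 0) J_hom normr0 mul0r. Qed.

Lemma homN u : J (- u) = J u.
Proof. by rewrite -scaleN1r J_hom normrN1 mul1r. Qed.

(** By homogeneity, convexity at the midpoint of [u] and [v] is the triangle
    inequality. *)
Lemma seminormD u v : J (u + v) <= J u + J v.
Proof.
have h01 : 0 <= (2^-1 : R) <= 1 by rewrite invr_ge0 invf_le1//; lra.
pose t : {i01 R} := Itv01 (andP h01).1 (andP h01).2.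
have := J_convex t (mem_set (I : [set: 'rV[R]_n] u)) (mem_set (I : [set: 'rV[R]_n] v)).
rewrite convRE /=; rewrite [X in J X](_ : _ = 2^-1 *: (u + v)); last first.
  by rewrite scalerDr; congr (_ + _ *: _); rewrite /= /unstable.onem; lra.
rewrite J_hom ger0_norm ?invr_ge0// /unstable.onem; lra.
Qed.

Lemma seminorm_sum (I : Type) (r : seq I) (F : I -> 'rV[R]_n) :
  J (\sum_(i <- r) F i) <= \sum_(i <- r) J (F i).
Proof.
elim/big_rec2 : _ => [|i x u _ IH]; first by rewrite hom0.
by rewrite (le_trans (seminormD _ _))// lerD2l.
Qed.

Lemma seminorm_le_coord u : J u <= \sum_(i < n) `|u 0 i| * J 'e_i.
Proof.
rewrite {1}(row_sum_delta u) (le_trans (seminorm_sum _ _))//.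
by apply: ler_sum => i _; rewrite J_hom.
Qed.

Lemma seminorm_le_enorm : exists2 C, 0 <= C & forall u, J u <= C * enorm u.
Proof.
exists (\sum_(i < n) J 'e_i) => [|u]; first exact: sumr_ge0.
rewrite (le_trans (seminorm_le_coord u))// mulr_suml; apply: ler_sum => i _.
by rewrite mulrC ler_wpM2l// coord_le_enorm.
Qed.

Lemma seminorm_dist u v : `|J u - J v| <= J (u - v).
Proof.
rewrite ler_norml; apply/andP; split.
  rewrite lerNl opprB lerBlDr -(homN (u - v)) opprB.
  by rewrite -{1}(subrK u v) seminormD.
by rewrite lerBlDr -{1}(subrK v u) seminormD.
Qed.

Lemma continuous_seminorm : continuous J.
Proof.
move=> u; apply/(@cvgrPdist_le _ _ _ (nbhs u)) => e e0.
have : \sum_(i < n) `|(u - v) 0 i| * J 'e_i @[v --> u] --> \sum_(i < n) `|(u - u) 0 i| * J 'e_i.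
  apply: (@cvg_sumR _ _ (nbhs u)) => i; apply: cvgMr_tmp; apply: cvg_norm.
  apply: (@continuous_comp _ _ _ (fun v => u - v) (fun w : 'rV[R]_n => w 0 i)).
    by apply: (@cvgB _ _ _ (nbhs u)); [exact: cvg_cst|exact: cvg_id].
  exact: coord_continuous.
rewrite [X in _ --> X](_ : _ = 0); last first.
  by apply: big1 => i _; rewrite subrr mxE normr0 mul0r.
move=> /cvgr_le /(_ _ e0) h; near=> v.
rewrite (le_trans (seminorm_dist _ _))// (le_trans (seminorm_le_coord _))//.
near: v; exact: h.
Unshelve. all: by end_near. Qed.

(** The optimality conditions of the proximal problem: [f - u] belongs to [t]
    times the subdifferential of [J] at [u]. *)
Definition is_prox (f : 'rV[R]_n) (t : R) u :=
  (forall w, dot (f - u) w <= t * J w) /\ dot (f - u) u = t * J u.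

(** The quadratic term makes the optimality conditions sufficient, with a
    quadratic growth of the energy that forces uniqueness. *)
Lemma is_prox_energy f t u : is_prox f t u ->
  forall w, VM_energy J f t u + 2^-1 * enorm (w - u) ^+ 2 <= VM_energy J f t w.
Proof.
move=> [h1 h2] w; rewrite /VM_energy !enorm_sqr; have := h1 w; move: h2.
rewrite !dotE (dotC u f) (dotC w f) (dotC w u); lra.
Qed.

(** First-order expansion of the energy at [u + e w]. The direction [w = - u]
    is used as well: along it [J] is affine, which yields the equality. *)
Lemma minimizer_is_prox f t u : 0 <= t ->
  (forall w, VM_energy J f t u <= VM_energy J f t w) -> is_prox f t u.
Proof.
move=> t0 umin.
have step (w : 'rV[R]_n) e : 
    e * dot (f - u) w <= e ^+ 2 * (2^-1 * dot w w) + t * (J (u + e *: w) - J u).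
  have := umin (u + e *: w); rewrite /VM_energy !enorm_sqr !dotE.
  rewrite (dotC u f) (dotC w f) (dotC w u); lra.
(* division by e, then e tends to 0 *)
have lim (a b c : R) : 0 <= c ->
    (forall e, 0 < e -> e <= 1 -> e * a <= e ^+ 2 * c + e * b) -> a <= b.
  move=> c0 h; rewrite leNgt; apply/negP => ba.
  pose e := Num.min 1 ((a - b) / (2 * (c + 1))).
  have e0 : 0 < e by rewrite lt_min ltr01/= divr_gt0//; lra.
  have e1 : e <= 1 by rewrite ge_min lexx.
  have := h e e0 e1.
  rewrite expr2 -mulrA -mulrDr ler_pM2l// => h1.
  have h2 : e * (c + 1) <= (a - b) / 2.
    rewrite -ler_pdivlMr; last lra.
    rewrite /e ge_min; apply/orP; right.
    by rewrite -mulrA -invfM.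
  have := mulr_ge0 (ltW e0) c0; nra.
split=> [w|].
  apply: (lim _ _ (2^-1 * dot w w)); first by rewrite mulr_ge0 ?dot_ge0// invr_ge0.
  move=> e e0 _; rewrite (le_trans (step w e))// lerD2l mulrCA ler_wpM2l//.
  by rewrite lerBlDl (le_trans (seminormD _ _))// J_hom gtr0_norm.
apply/eqP; rewrite eq_le; apply/andP; split.
  apply: (lim _ _ (2^-1 * dot u u)); first by rewrite mulr_ge0 ?dot_ge0// invr_ge0.
  move=> e e0 _; rewrite (le_trans (step u e))// lerD2l mulrCA ler_wpM2l//.
  by rewrite lerBlDl (le_trans (seminormD _ _))// J_hom gtr0_norm.
rewrite -lerN2.
apply: (lim _ _ (2^-1 * dot u u)); first by rewrite mulr_ge0 ?dot_ge0// invr_ge0.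
move=> e e0 e1; have := step (- u) e.
have -> : u + e *: - u = (1 - e) *: u by rewrite scalerBl scale1r scalerN.
rewrite !dotNr !dotNl J_hom ger0_norm ?subr_ge0//; lra.
Qed.

Lemma uVM_is_prox f t : 0 < t -> is_prox f t (uVM J f t).
Proof.
move=> t0; rewrite /uVM t0; apply: minimizer_is_prox; first exact: ltW.
have [|||u _ umin] := @proximal_exists _ _ setT (fun u => t * J u) f closedT.
- by exists f.
- by move=> u; apply: (@cvgMl_tmp _ _ (nbhs u)); exact: continuous_seminorm.
- by move=> u; rewrite mulr_ge0// ltW.
have : [set u | forall w, VM_energy J f t u <= VM_energy J f t w] u.
  by move=> w; exact: umin.
by case: xgetP => [y _ //|/(_ u)].
Qed.

Lemma is_prox_uVM f t u : 0 < t -> is_prox f t u -> uVM J f t = u.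
Proof.
move=> t0 hu; apply/eqP; rewrite -subr_eq0 -enorm_eq0 -sqrf_eq0.
have h1 := is_prox_energy hu (uVM J f t).
have h2 := is_prox_energy (uVM_is_prox f t0) u.
rewrite -(opprB u) enorm_sqr dotNl dotNr opprK -enorm_sqr in h1.
rewrite -(opprB u) enorm_sqr dotNl dotNr opprK -enorm_sqr.
rewrite eq_le sqr_ge0 andbT; lra.
Qed.

(** With [u_t = f - t p_t], where [p_t] is a subgradient of [J] at [u_t],
    monotonicity of the subdifferential gives
    [|u_s - u_t|^2 <= |s - t| |p_s| |u_s - u_t|], and subgradients are bounded
    by any constant [C] with [J <= C |.|]. *)
Lemma uVM_lipschitz f : exists2 L, 0 <= L & forall s t, 0 <= s -> 0 <= t ->
  enorm (uVM J f s - uVM J f t) <= L * `|s - t|.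
Proof.
have [C C0 JC] := seminorm_le_enorm; exists C => // s t s0 t0.
have uVM0 : uVM J f 0 = f by rewrite /uVM ltxx.
have subgrad r : 0 <= r -> enorm (f - uVM J f r) <= C * r.
  rewrite le_eqVlt => /predU1P[<-|r0].
    by rewrite uVM0 subrr mulr0 le_eqVlt enorm_eq0 eqxx.
  have [h _] := uVM_is_prox f r0; have := h (f - uVM J f r).
  rewrite -enorm_sqr => h1; set x := enorm _ in h1 *.
  have : x ^+ 2 <= r * C * x.
    by rewrite (le_trans h1)// -mulrA ler_wpM2l ?JC// ltW.
  have : 0 <= x by exact: enorm_ge0.
  rewrite le_eqVlt => /predU1P[<- _|x0]; first by rewrite mulr_ge0// ltW.
  by rewrite expr2 ler_pM2r// mulrC.
have key a b : 0 < a -> 0 < b -> enorm (uVM J f a - uVM J f b) <= C * `|a - b|.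
  move=> a0 b0.
  have [ha1 ha2] := uVM_is_prox f a0; have [hb1 hb2] := uVM_is_prox f b0.
  have := subgrad _ (ltW a0).
  set u := uVM J f a in ha1 ha2 *; set v := uVM J f b in hb1 hb2 *.
  set d := u - v => sg.
  have m : a * dot (f - v) d <= b * dot (f - u) d.
    have h1 := ha1 v; have h2 := hb1 u.
    have h3 : b * dot (f - u) v <= b * (a * J v) by rewrite ler_pM2l.
    have h4 : a * dot (f - v) u <= a * (b * J u) by rewrite ler_pM2l.
    by rewrite /d !dotDr !dotNr ha2 hb2; lra.
  have e : f - v = (f - u) + d by rewrite /d addrA subrK.
  have m2 : a * enorm d ^+ 2 <= a * (C * `|a - b| * enorm d).
    apply: (@le_trans _ _ ((b - a) * dot (f - u) d)).
      by move: m; rewrite e (dotDl (f - u) d d) enorm_sqr; lra.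
    rewrite (le_trans (ler_norm _))// normrM distrC.
    have := le_trans (cauchy_schwarz (f - u) d) (ler_wpM2r (enorm_ge0 d) sg).
    move=> /(ler_wpM2l (normr_ge0 (a - b))) /le_trans; apply.
    by rewrite le_eqVlt; apply/orP; left; apply/eqP; ring.
  move: m2; rewrite ler_pM2l//.
  have := enorm_ge0 d; rewrite le_eqVlt => /predU1P[<- _|d0].
    by rewrite mulr_ge0.
  by rewrite expr2 ler_pM2r.
have key0 b : 0 <= b -> enorm (uVM J f 0 - uVM J f b) <= C * `|0 - b|.
  by move=> b0; rewrite uVM0 sub0r normrN ger0_norm// subgrad.
move: s0; rewrite le_eqVlt => /predU1P[<-|s0]; first exact: key0.
move: t0; rewrite le_eqVlt => /predU1P[<-|t0]; last exact: key.
by rewrite -opprB -scaleN1r enormZ normrN1 mul1r distrC key0// ltW.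
Qed.

(** The orthogonal projection on the kernel of [J] is the proximal map for the
    zero function on that kernel; orthogonality is tested along lines. *)
Lemma proj_kernel (g : 'rV[R]_n) :
  exists2 u, J u = 0 & forall z, J z = 0 -> dot (g - u) z = 0.
Proof.
have cN : closed [set u | J u = 0].
  exact: (continuous_closedP J).1 continuous_seminorm _ (@closed_eq R 0).
have [|||u u0 umin] := @proximal_exists _ _ _ (fun=> 0) g cN.
- by exists 0; exact: hom0.
- exact: cst_continuous.
- by [].
exists u => // z z0.
have zN e : J (u + e *: z) = 0.
  apply/eqP; rewrite eq_le J_ge0 andbT (le_trans (seminormD _ _))//.
  by rewrite u0 J_hom z0 mulr0 addr0.
have q e : 0 <= 2^-1 * (e ^+ 2 * dot z z) - e * dot (g - u) z.
  have := umin _ (zN e); rewrite !addr0 !enorm_sqr !dotE.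
  rewrite (dotC u g) (dotC z g) (dotC z u); lra.
have zz := dot_ge0 z.
(* nearly the minimizer of q; the + 1 keeps it defined when z is zero *)
have := q (dot (g - u) z / (dot z z + 1)).
have z1 : 0 < dot z z + 1 by lra.
set a := dot z z in zz z1 *; set b := dot _ _; set e := b / _ => h.
have be : b = e * (a + 1) by rewrite /e divfK// gt_eqF.
rewrite be in h *.
have e0 : e ^+ 2 <= 0 by move: h; have := mulr_ge0 zz (sqr_ge0 e); nra.
have -> : e = 0 by apply/eqP; rewrite -sqrf_eq0 eq_le e0 sqr_ge0.
by rewrite mul0r.
Qed.

(** [J] is a norm on the orthogonal complement of its kernel, hence attains a
    positive minimum on the unit sphere there, which is compact; if this sphere
    is empty, the complement is zero and any [c] will do. *)
Lemma seminorm_coercive : exists2 c, 0 < c & forall w,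
  (forall z, J z = 0 -> dot w z = 0) -> c * enorm w <= J w.
Proof.
pose P w := forall z, J z = 0 -> dot w z = 0.
pose S := [set w : 'rV[R]_n | enorm w = 1] `&`
  \bigcap_(z in [set z | J z = 0]) [set w | dot w z = 0].
have cS : closed S.
  apply: closedI.
    exact: (continuous_closedP (@enorm R n)).1 (@continuous_enorm R n) _ (@closed_eq R 1).
  apply: closed_bigI => z _.
  apply: ((continuous_closedP (fun w => dot w z)).1 _ _ (@closed_eq R 0)) => w.
  rewrite /continuous_at /dot; apply: (@cvg_sumR _ _ (nbhs w)) => i.
  by apply: cvgMr_tmp; exact: coord_continuous.
have kS : compact S.
  apply: (closed_coord_bounded_compact (M := 1)) => // u i [/= u1 _].
  by rewrite -u1 coord_le_enorm.
have unitS w : P w -> w != 0 -> S ((enorm w)^-1 *: w).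
  move=> Pw w0; split=> [/=|z /= z0]; last by rewrite dotZl Pw// mulr0.
  by rewrite enormZ ger0_norm ?invr_ge0 ?enorm_ge0// mulVf// enorm_eq0.
have [S0|/set0P/negP/negPn/eqP S0] := pselect (S !=set0); last first.
  exists 1 => // w Pw; have [->|w0] := eqVneq w 0.
    by rewrite (eqP (_ : enorm 0 == 0)) ?enorm_eq0// mulr0.
  by have := unitS _ Pw w0; rewrite S0.
have [c /set_mem[c1 Pc] cmin] := EVT_min_rV S0 kS (continuous_subspaceT continuous_seminorm).
have Jc : 0 < J c.
  rewrite lt0r J_ge0 andbT; apply/eqP => Jc0.
  by have := Pc _ Jc0; rewrite /= -enorm_sqr c1 expr1n => /eqP; rewrite oner_eq0.
exists (J c) => // w Pw; have [->|w0] := eqVneq w 0.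
  by rewrite (eqP (_ : enorm 0 == 0)) ?enorm_eq0// mulr0.
have w0' : 0 < enorm w by rewrite lt0r enorm_eq0 w0 enorm_ge0.
have := cmin _ (mem_set (unitS _ Pw w0)).
by rewrite J_hom ger0_norm ?invr_ge0 ?enorm_ge0// mulrC ler_pdivlMr.
Qed.

(** The limit is the orthogonal projection [u] of [f] on the kernel of [J]:
    [f - u] is orthogonal to the kernel, where [J] dominates a multiple of the
    norm, so that [f - u] is a subgradient of [t J] at [u] once [t] is large. *)
Lemma uVM_extinction f : exists2 T, 0 < T &
  exists u, forall t, T <= t -> uVM J f t = u.
Proof.
have [c c0 Jc] := seminorm_coercive.
have [u u0 uN] := proj_kernel f.
have T0 : 0 < enorm (f - u) / c + 1.
  by rewrite ltr_wpDl// divr_ge0 ?enorm_ge0// ltW.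
exists (enorm (f - u) / c + 1) => //; exists u => t Tt.
apply: is_prox_uVM; first exact: lt_le_trans Tt.
split; last by rewrite uN// u0 mulr0.
move=> w; have [z z0 zN] := proj_kernel w.
have -> : dot (f - u) w = dot (f - u) (w - z).
  by rewrite (dotDr w (- z)) (dotNr _ z) (uN z)// subr0.
apply: le_trans (ler_norm _) _; apply: le_trans (cauchy_schwarz _ _) _.
have h : c * enorm (w - z) <= J w.
  apply: le_trans (Jc _ zN) _; apply: le_trans (seminormD _ _) _.
  by rewrite homN z0 addr0.
have e0 := enorm_ge0 (f - u).
apply: (@le_trans _ _ (enorm (f - u) / c * J w)); last first.
  by rewrite ler_wpM2r// (le_trans _ Tt)// lerDl.
by rewrite -mulrA ler_wpM2l// ler_pdivlMl.
Qed.

End seminorm.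

(** * Smooth bumps *)

Section flat_functions.
Context {R : realType}.
Implicit Types (p q : {poly R}) (x : R).

(** The functions [p(1/x) exp(-1/x)], extended by [0] to [x <= 0]: a family
    closed under differentiation that contains the classical flat function. *)
Definition flat p x : R := if 0 < x then p.[x^-1] * expR (- x^-1) else 0.

(** The series of [exp y] dominates [y ^ i / i!] for each monomial of [p], with
    [y = 1/x]. *)
Lemma flat_bounded p : exists M, forall x, `|flat p x| <= M.
Proof.
exists (\sum_(i < size p) `|p`_i| * i`!%:R) => x; rewrite /flat.
case: ifPn => [x0|_]; last by rewrite normr0 sumr_ge0.
have y0 : 0 <= x^-1 by rewrite invr_ge0 ltW.
rewrite horner_coef mulr_suml (le_trans (ler_norm_sum _ _ _))//.
apply: ler_sum => i _; rewrite -mulrA normrM ler_wpM2l//.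
rewrite ger0_norm ?mulr_ge0 ?exprn_ge0 ?expR_ge0// expRN ler_pdivrMr ?expR_gt0//.
case: (nat_of_ord i) => [|k].
  by rewrite expr0 fact0 mul1r (le_trans _ (expR_ge1Dx _))// lerDl.
rewrite mulrC -ler_pdivrMr ?ltr0n ?fact_gt0//.
by rewrite (le_trans _ (expR_ge1Dxn k y0))// lerDr.
Qed.

Lemma flatMX p x : flat p x = x * flat ('X * p) x.
Proof.
rewrite /flat; case: ifPn => x0; last by rewrite mulr0.
by rewrite hornerM hornerX !mulrA mulfV ?mul1r// gt_eqF.
Qed.

(** At [0] the difference quotient of [flat p] is [flat ('X * p)], which is [x]
    times a bounded function by [flatMX]. *)
Lemma is_derive_flat p x : is_derive x 1 (flat p) (flat ('X^2 * (p - p^`())) x).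
Proof.
have [x0|x0|<-] := ltgtP 0 x.
- apply: (@near_eq_is_derive R R^o R^o (fun y => p.[y^-1] * expR (- y^-1))).
    by near=> y; rewrite /flat ifT//; near: y; exact: lt_nbhsr.
  have dV : is_derive x 1 (fun y : R => y^-1) (- x ^- 2).
    have := @is_deriveV _ (fun y : R => y) x 1 1.
    by rewrite gt_eqF// => /(_ isT (is_derive_id _ _)); rewrite scaler1.
  have dp := @is_derive1_comp _ (horner p) _ _ _ _ (is_derive_poly p _) dV.
  have de := @is_derive1_comp _ expR _ _ _ _ (is_derive_expR _) (is_deriveN dV).
  apply: (is_derive_eq (is_deriveM dp de)).
  rewrite /flat x0 !hornerE /= -![_ *: _]/(_ * _) exprVn; ring.
- apply: (@near_eq_is_derive R R^o R^o (cst 0)).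
    near=> y; rewrite /flat ifF//; apply/negbTE; rewrite -leNgt ltW//.
    by near: y; exact: lt_nbhsl.
  by rewrite /flat ltNge ltW//=; exact: is_derive_cst.
- apply/is_derive1_caratheodory; exists (flat ('X * p)); split.
  + by move=> z; rewrite [flat p 0]/flat ltxx !subr0 flatMX mulrC.
  + have f0 : flat ('X * p) 0 = 0 by rewrite /flat ltxx.
    rewrite /prop_for /continuous_at f0.
    have [M Mb] := flat_bounded ('X * ('X * p)).
    apply/cvgr0Pnorm_le => e e0; near=> z.
    rewrite flatMX normrM.
    have z1 : `|z| <= e / (`|M| + 1).
      near: z; apply: (@cvgr0_norm_le _ _ _ (nbhs (0 : R)) _ id) => //.
      by rewrite divr_gt0// ltr_wpDl.
    apply: (le_trans (ler_pM (normr_ge0 _) (normr_ge0 _) z1 (le_trans (Mb z) (ler_norm M)))).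
    rewrite mulrAC ler_pdivrMr ?ltr_wpDl// ler_wpM2l ?ltW//; lra.
  + by rewrite /flat ltxx.
Unshelve. all: by end_near. Qed.

Lemma flat1_ge0 x : 0 <= flat 1 x.
Proof. by rewrite /flat; case: ifP => // _; rewrite hornerC mul1r expR_ge0. Qed.

Lemma flat1_le1 x : flat 1 x <= 1.
Proof.
rewrite /flat; case: ifP => // x0.
by rewrite hornerC mul1r -expR0 ler_expR oppr_le0 invr_ge0 ltW.
Qed.

Lemma flat1_scale_cvg x : 0 < x -> flat 1 (n.+1%:R * x) @[n --> \oo] --> (1 : R).
Proof.
move=> x0.
have -> : (fun n => flat 1 (n.+1%:R * x)) = (fun n => expR (- (n.+1%:R^-1 * x^-1))).
  apply/funext => n; rewrite /flat mulr_gt0 ?ltr0n// hornerC mul1r.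
  by rewrite invfM.
rewrite -[X in _ --> X]expR0.
apply: continuous_cvg; first exact: continuous_expR.
rewrite -[X in _ --> X]oppr0 -[X in _ --> - X](mul0r x^-1).
by apply: cvgN; apply: cvgMr_tmp; exact: cvg_harmonic.
Qed.

End flat_functions.

Section bump.
Context {R : realType} (c d k : R).

(** Products of two flat functions, one leaving [c] to the right and one leaving
    [d] to the left, closed under the scaled differences that the product rule
    creates. Their scale [k] is a parameter
    because the bumps approximate the indicator of [`]c, d[] as [k] grows. *)
Inductive bump_span : (R -> R) -> Prop :=
| bump_prod p q : bump_span (fun x => flat p (k * (x - c)) * flat q (k * (d - x)))
| bump_lin a f g : bump_span f -> bump_span g ->
    bump_span (fun x => a * (f x - g x)).

Lemma bump_span_derive f : bump_span f ->
  exists2 f', bump_span f' & forall x : R, is_derive x 1 f (f' x).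
Proof.
elim=> [p q|a f1 f2 _ [f1' s1 d1] _ [f2' s2 d2]].
- exists (fun x => k *
      (flat ('X^2 * (p - p^`())) (k * (x - c)) * flat q (k * (d - x)) -
       flat p (k * (x - c)) * flat ('X^2 * (q - q^`())) (k * (d - x)))).
    by apply: bump_lin; exact: bump_prod.
  move=> x.
  have dl : is_derive x 1 (fun x : R => k * (x - c)) k.
    apply: (is_derive_eq (is_deriveZ k (is_deriveB (is_derive_id x (1 : R)) (is_derive_cst c x 1)))).
    by rewrite subr0 -[_ *: _]/(_ * _) mulr1.
  have dr : is_derive x 1 (fun x : R => k * (d - x)) (- k).
    apply: (is_derive_eq (is_deriveZ k (is_deriveB (is_derive_cst d x 1) (is_derive_id x (1 : R))))).
    by rewrite sub0r -[_ *: _]/(_ * _) mulrN1.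
  have dp := @is_derive1_comp _ (flat p) _ _ _ _ (is_derive_flat p _) dl.
  have dq := @is_derive1_comp _ (flat q) _ _ _ _ (is_derive_flat q _) dr.
  apply: (is_derive_eq (is_deriveM dp dq)).
  by rewrite -![_ *: _]/(_ * _) /=; ring.
- exists (fun x => a * (f1' x - f2' x)); first exact: bump_lin.
  by move=> x; exact: (is_deriveZ a (is_deriveB (d1 x) (d2 x))).
Qed.

Lemma bump_span_smooth f : bump_span f -> forall j x, derivable (derive1n j f) x 1.
Proof.
move=> sf j.
have : bump_span (derive1n j f).
  elim: j => [|j /bump_span_derive[g sg dg]]; first by rewrite derive1n0.
  rewrite derive1nS (_ : derive1 _ = g)//; apply/funext => x.
  by rewrite derive1E; exact: derive_val.
by move=> /bump_span_derive[g _ dg] x; exact: ex_derive.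
Qed.

End bump.

Section bump_test.
Context {R : realType}.

(** Its values increase to those of the indicator of [`]c, d[] as [k] tends to
    infinity. *)
Definition bump (c d k x : R) : R := flat 1 (k * (x - c)) * flat 1 (k * (d - x)).

Lemma bump_out c d k x : 0 < k -> x \notin `]c, d[ -> bump c d k x = 0.
Proof.
move=> k0; rewrite in_itv/= negb_and -!leNgt => /orP[h|h]; rewrite /bump.
  by rewrite [flat 1 _]/flat pmulr_rgt0// subr_gt0 ltNge h/= mul0r.
by rewrite [X in _ * X]/flat pmulr_rgt0// subr_gt0 ltNge h/= mulr0.
Qed.

Lemma bump_itv01 c d k x : 0 <= bump c d k x <= 1.
Proof.
by rewrite mulr_ge0 ?flat1_ge0// mulr_ile1 ?flat1_ge0 ?flat1_le1.
Qed.

Lemma bump_cvg c d x : x \in `]c, d[ -> bump c d n.+1%:R x @[n --> \oo] --> (1 : R).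
Proof.
rewrite in_itv/= => /andP[cx xd]; rewrite -[X in _ --> X](mulr1 1).
rewrite -subr_gt0 in cx; rewrite -subr_gt0 in xd.
exact: cvgM (flat1_scale_cvg cx) (flat1_scale_cvg xd).
Qed.

Lemma bump_Cc_infty (Omega : set R) c d k : 0 < k -> `[c, d] `<=` Omega ->
  Cc_infty Omega (bump c d k).
Proof.
move=> k0 cdO; split.
  by move=> j x; apply: bump_span_smooth; exact: bump_prod.
exists `[c, d]%classic; split => //; first exact: segment_compact.
move=> x /= xcd; apply: bump_out => //; apply/negP => h; apply: xcd.
exact: subset_itv_oo_cc h.
Qed.

End bump_test.

(** * The lemma of du Bois-Reymond *)

Section lebesgue_ae.
Context {R : realType}.
Implicit Types P Q S : R -> Prop.
Notation mu := (@lebesgue_measure R).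

Lemma ae_imply P Q : (forall x, P x -> Q x) ->
  {ae mu, forall x, P x} -> {ae mu, forall x, Q x}.
Proof. by move=> PQ; apply: filterS; first exact: (ae_filter_ringOfSetsType mu). Qed.

Lemma ae_imply2 P Q S : (forall x, P x -> Q x -> S x) ->
  {ae mu, forall x, P x} -> {ae mu, forall x, Q x} -> {ae mu, forall x, S x}.
Proof. by move=> PQ; apply: filterS2; first exact: (ae_filter_ringOfSetsType mu). Qed.

Lemma integrable_Zl (D : set R) (f : R -> R) k : measurable D ->
  mu.-integrable D (EFin \o f) -> mu.-integrable D (EFin \o (fun t => k * f t)).
Proof. by move=> mD fi; apply: integrableZl fi; exact: mD. Qed.

Lemma integrable_add (D : set R) (f g : R -> R) : measurable D ->
  mu.-integrable D (EFin \o f) -> mu.-integrable D (EFin \o g) ->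
  mu.-integrable D (EFin \o (fun t => f t + g t)).
Proof. by move=> mD fi gi; apply: integrableD fi gi; exact: mD. Qed.

Lemma integrable_sub (D : set R) (f g : R -> R) : measurable D ->
  mu.-integrable D (EFin \o f) -> mu.-integrable D (EFin \o g) ->
  mu.-integrable D (EFin \o (fun t => f t - g t)).
Proof. by move=> mD fi gi; apply: integrableB fi gi; exact: mD. Qed.

Lemma ae_eq_Rintegral (D : set R) (f g : R -> R) : measurable D ->
  measurable_fun D f -> measurable_fun D g ->
  {ae mu, forall x, D x -> f x = g x} ->
  \int[mu]_(x in D) f x = \int[mu]_(x in D) g x.
Proof.
move=> mD mf mg fg; congr fine; apply: ae_eq_integral => //.
- by apply/measurable_EFinP; exact: mf.
- by apply/measurable_EFinP; exact: mg.
- by apply: ae_imply fg => x h Dx /=; rewrite h.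
Qed.

Lemma ae_eq_integrable (D : set R) (f g : R -> R) : measurable D ->
  measurable_fun D f -> {ae mu, forall x, D x -> f x = g x} ->
  mu.-integrable D (EFin \o g) -> mu.-integrable D (EFin \o f).
Proof.
move=> mD mf fg /integrableP[mg ig]; apply/integrableP.
have mf' : measurable_fun D (EFin \o f) by apply/measurable_EFinP; exact: mf.
split; first exact: mf'.
have -> : (\int[mu]_(x in D) `|(EFin \o f) x| = \int[mu]_(x in D) `|(EFin \o g) x|)%E.
  apply: ae_eq_integral => //.
  - exact: measurableT_comp.
  - exact: measurableT_comp.
  - by apply: ae_imply fg => x h Dx /=; rewrite h.
exact: ig.
Qed.

End lebesgue_ae.

Section test_functions.
Context {R : realType}.
Implicit Types (Omega K : set R) (phi psi w : R -> R).
Notation mu := (@lebesgue_measure R).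

(** Continuous with compact support in [Omega]: the class to which both a test
    function and its derivative belong. *)
Definition Cc Omega psi := continuous psi /\
  exists K : set R, [/\ compact K, K `<=` Omega & forall x, ~ K x -> psi x = 0].

Lemma Cc_infty_Cc Omega phi : Cc_infty Omega phi -> Cc Omega phi.
Proof.
move=> [dphi cK]; split=> // x.
by apply/differentiable_continuous/derivable1_diffP; exact: (dphi 0).
Qed.

Lemma Cc_infty_derive Omega phi : Cc_infty Omega phi -> Cc Omega (derive1 phi).
Proof.
move=> [dphi [K [cK KO K0]]]; split=> [x|].
  by apply/differentiable_continuous/derivable1_diffP; exact: (dphi 1).
exists K; split => // x Kx; rewrite derive1E.
rewrite (@near_eq_derive _ R^o R^o phi (cst 0)) ?derive_cst//.
have oK : open (~` K) by apply: closed_openC; exact: compact_closed cK.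
by near=> y; apply: K0; near: y; exact: open_nbhs_nbhs.
Unshelve. all: by end_near. Qed.

Lemma Cc_measurable Omega psi D : Cc Omega psi -> measurable_fun D psi.
Proof. by move=> [c _]; apply: measurable_funTS; exact: continuous_measurable_fun. Qed.

Lemma Cc_bounded Omega psi : Cc Omega psi -> exists M, forall x, `|psi x| <= M.
Proof.
move=> [c [K [cK KO K0]]].
have /compact_bounded[M [_ Mb]] := continuous_compact (continuous_subspaceT c) cK.
exists (`|M| + 1) => x; have [Kx|/K0->] := pselect (K x).
  by apply: Mb; [rewrite ltr_pwDr// ler_norm|exists x].
by rewrite normr0 addr_ge0.
Qed.

Lemma locally_integrable_integrable Omega K w : locally_integrable Omega w ->
  K `<=` Omega -> compact K -> mu.-integrable K (EFin \o w).
Proof.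
move=> [mw oO iw] KO cK; apply/integrableP; split; last exact: iw.
by apply/measurable_EFinP; apply: measurable_funS mw => //; exact: open_measurable.
Qed.

Lemma locally_integrable_Cc Omega w psi : locally_integrable Omega w ->
  Cc Omega psi -> mu.-integrable Omega (EFin \o (fun x => w x * psi x)).
Proof.
move=> lw cpsi; have [mw oO _] := lw; have mO := open_measurable oO.
have [M Mb] := Cc_bounded cpsi.
have [_ [K [cK KO K0]]] := cpsi.
have mK := compact_measurable cK.
have iK : mu.-integrable K (EFin \o (fun x => w x * psi x)).
  have := @integrableMl _ _ _ mu K mK (EFin \o w) psi (locally_integrable_integrable lw KO cK).
  apply; first exact: Cc_measurable cpsi.
  exists M; split; first exact: num_real.
  by move=> y My x _; rewrite /= (le_trans (Mb x))// ltW.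
have eqr : (EFin \o (fun x => w x * psi x)) \_ Omega = (EFin \o (fun x => w x * psi x)) \_ K.
  apply/funext => x; rewrite !patchE; case: ifPn => xO; case: ifPn => // xK.
    by rewrite /= K0 ?mulr0// => /mem_set; apply/negP.
  by case/negP: xO; apply: mem_set; apply: KO; exact: set_mem.
apply/integrable_mkcond; first exact: mO.
by rewrite eqr; apply: (iffLR (integrable_mkcond _ _)) iK; exact: mK.
Qed.

End test_functions.

Section du_bois_reymond.
Context {R : realType}.
Notation mu := (@lebesgue_measure R).

(** The bumps converge to the indicator of the interval, and dominated
    convergence applies. *)
Lemma integral_bump0 (Omega : set R) (w : R -> R) c d :
  locally_integrable Omega w -> `[c, d] `<=` Omega ->
  (forall phi, Cc_infty Omega phi -> \int[mu]_(t in Omega) (w t * phi t) = 0) ->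
  \int[mu]_(t in `[c, d]) w t = 0.
Proof.
move=> lw cdO w0; have [mw oO _] := lw; have mO := open_measurable oO.
have icd := locally_integrable_integrable lw cdO (@segment_compact _ c d).
have icd' : mu.-integrable `]c, d[ (EFin \o w).
  by apply: integrableS icd => //; exact: subset_itv_oo_cc.
have mI : measurable_fun `]c, d[ w by apply/measurable_EFinP; exact: measurable_int icd'.
have z n : (\int[mu]_(t in `]c, d[) (w t * bump c d n.+1%:R t)%:E = 0)%E.
  have bC := bump_Cc_infty (ltr0Sn R n) cdO.
  have iO := locally_integrable_Cc lw (Cc_infty_Cc bC).
  transitivity (\int[mu]_(t in Omega) (w t * bump c d n.+1%:R t)%:E)%E; last first.
    by rewrite -[LHS]fineK ?(integrable_fin_num _ iO)//; congr EFin; exact: w0.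
  rewrite integral_mkcond [RHS]integral_mkcond.
  apply: eq_integral => x _; rewrite !patchE.
  case: ifPn => xI; case: ifPn => // xO.
    case/negP: xO; apply: mem_set; apply: cdO; apply: subset_itv_oo_cc.
    exact: set_mem.
  rewrite /= bump_out ?mulr0//; apply/negP => h; move/negP: xI; apply.
  exact: mem_set.
have mb n : measurable_fun `]c, d[ (bump c d n.+1%:R).
  by apply: Cc_measurable (Cc_infty_Cc (bump_Cc_infty (ltr0Sn R n) (subset_refl (A := `[c, d]%classic)))).
have [|||||_ _] := @dominated_convergence _ _ _ mu `]c, d[%classic (measurable_itv _)
  (fun n t => (w t * bump c d n.+1%:R t)%:E) (EFin \o w) (fun t => `|w t|%:E).
- by move=> n; apply/measurable_EFinP; apply: measurable_funM; [exact: mI|exact: mb].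
- exact: measurable_int icd'.
- apply: aeW => x xI; apply: cvg_EFin; first exact: nearW.
  by rewrite -[X in _ --> X]mulr1; apply: cvgMl_tmp; exact: bump_cvg.
- exact: integrable_norm icd'.
- apply: aeW => x n xI; rewrite lee_fin normrM ler_piMr//.
  by have /andP[b0 b1] := bump_itv01 c d n.+1%:R x; rewrite ger0_norm.
rewrite (_ : [sequence _]_n = cst 0%E); last by apply/funext => n; exact: z.
move=> /cvg_lim lim; have e : (\int[mu]_(x in `]c, d[) (w x)%:E = 0)%E.
  by rewrite -lim// lim_cst.
rewrite -Rintegral_itv_bndo_bndc; last first.
  by apply: integrableS icd => //; exact: subset_itv_co_cc.
by rewrite -Rintegral_itv_obnd_cbnd// /Rintegral e.
Qed.

(** By [integral_bump0] the primitives of [w] are locally constant, while by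
    Lebesgue's differentiation theorem [w] is almost everywhere their
    derivative. *)
Lemma du_bois_reymond (Omega : set R) (w : R -> R) :
  locally_integrable Omega w ->
  (forall phi, Cc_infty Omega phi -> \int[mu]_(t in Omega) (w t * phi t) = 0) ->
  {ae mu, forall t, Omega t -> w t = 0}.
Proof.
move=> lw w0; have [mw oO _] := lw.
have seg c d : `[c, d] `<=` Omega -> {ae mu, forall t, t \in `[c, d] -> w t = 0}.
  move=> cdO; pose W := w \_ `[c, d].
  have icd := locally_integrable_integrable lw cdO (@segment_compact _ c d).
  have lW : locally_integrable setT W.
    by apply: integrable_locally_restrict.
  have iW : mu.-integrable setT (EFin \o W).
    by rewrite /W -restrict_EFin; apply: (iffLR (integrable_mkcond _ _)) icd.
  have iWy (y : R) : mu.-integrable `]-oo, y] (EFin \o W).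
    by apply: integrableS iW => //; exact: measurable_itv.
  have := FTC1Ny iWy lW.
  have -> : (fun y => \int[mu]_(t in `]-oo, y]) W t) = cst 0.
    apply/funext => y.
    rewrite /= -Rintegral_mkcondr.
    have -> : `]-oo, y]%classic `&` `[c, d]%classic = `[c, Num.min d y]%classic.
      apply/seteqP; split => x /=; rewrite !in_itv/= le_min.
        by move=> [-> /andP[-> ->]].
      by move=> /and3P[-> -> ->].
    apply: (integral_bump0 lw _ w0) => x /= xI; apply: cdO => /=; move: xI.
    by rewrite !in_itv/= le_min => /and3P[-> ->].
  apply: ae_imply => x [_]; rewrite derive1_cst => Wx xcd.
  by rewrite Wx /W patchE mem_set.
(* countably many rational segments cover the open set Omega *)
pose q n := odflt (0, 0) (unpickle n : option (rat * rat)).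
have : {ae mu, forall t n, `[ratr (q n).1, ratr (q n).2] `<=` Omega ->
    t \in `[ratr (q n).1, ratr (q n).2] -> w t = 0}.
  apply: ae_foralln => n.
  have [h|h] := pselect (`[ratr (q n).1, ratr (q n).2]%classic `<=` Omega).
    by have := seg _ _ h; apply: ae_imply => t + _; apply.
  by apply: aeW => t /h.
apply: ae_imply => t Ht Ot.
have [e /= e0 eO] : exists2 e : R, 0 < e & forall y, `|t - y| < e -> Omega y.
  have /nbhs_ballP[e /= e0 h] := open_nbhs_nbhs (conj oO Ot).
  by exists e.
have te1 : t - e < t by rewrite ltrBlDr ltrDl.
have te2 : t < t + e by rewrite ltrDl.
have [a /itvP ha] := rat_in_itvoo te1; have [b /itvP hb] := rat_in_itvoo te2.
have qab : q (pickle (a, b)) = (a, b) by rewrite /q pickleK.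
apply: (Ht (pickle (a, b))); rewrite qab /=; last first.
  by rewrite in_itv/= !ltW ?ha ?hb.
move=> y /=; rewrite in_itv/= => /andP[ay yb]; apply: eO.
have a1 : t - e < ratr a by rewrite ha.
have b1 : ratr b < t + e by rewrite hb.
by rewrite ltr_norml; lra.
Qed.

End du_bois_reymond.

(** * Primitives and Lipschitz functions *)

Section monotone_density.
Context {R : realType}.
Notation mu := (@lebesgue_measure R).

Lemma lebesgue_stieltjes_oc (G : cumulative R R) a b : a <= b ->
  lebesgue_stieltjes_measure G `]a, b] = (G b - G a)%:E.
Proof.
move=> ab; rewrite /lebesgue_stieltjes_measure /measure_extension/=.
by rewrite measurable_mu_extE/= ?wlength_itv_bnd//; exact: is_ocitv.
Qed.

(** Both [G] and [x - G] are nondecreasing, and their Stieltjes measures add up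
    to Lebesgue measure, so that the one of [G] has a Radon-Nikodym density.
    Restricting it to [`]0, T]] makes it a finite measure. *)
Lemma slow_monotone_density (G : R -> R) (T : R) :
  {homo G : x y / x <= y} -> (forall x y, x <= y -> G y - G x <= y - x) ->
  exists r : R -> R, mu.-integrable setT (EFin \o r) /\
    forall a b, 0 <= a -> a <= b -> b <= T ->
      G b - G a = \int[mu]_(t in `]a, b]) r t.
Proof.
move=> ndG slowG.
have cG : right_continuous G.
  move=> x; apply/cvgrPdist_le => e e0; near=> y.
  have xy : x <= y by near: y; exact: nbhs_right_ge.
  rewrite distrC ger0_norm ?subr_ge0 ?ndG// (le_trans (slowG _ _ xy))//.
  by rewrite lerBlDl; near: y; apply: nbhs_right_le; rewrite ltrDl.
pose C x := x - G x.
have ndC : {homo C : x y / x <= y}.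
  by move=> x y xy; have := slowG _ _ xy; rewrite /C; lra.
have cC : right_continuous C.
  by move=> x; apply: cvgB; [exact: cvg_within|exact: cG].
pose Gm : cumulative R R := HB.pack G (isCumulative.Build R _ R G ndG cG).
pose Cm : cumulative R R := HB.pack C (isCumulative.Build R _ R C ndC cC).
pose nuG : {measure set (measurableTypeR R) -> \bar R} := lebesgue_stieltjes_measure Gm.
pose nuC : {measure set (measurableTypeR R) -> \bar R} := lebesgue_stieltjes_measure Cm.
have muE A : measurable A -> mu A = (nuG A + nuC A)%E.
  move=> mA; rewrite -(measure_addE nuG nuC).
  apply: (lebesgue_measure_unique (mu := measure_add nuG nuC)) mA => X [[a b] _ <-]; rewrite /fst /snd.
  rewrite [RHS]measure_addE.
  have [ab|ba] := leP a b; last first.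
    by rewrite set_itv_ge ?bnd_simp -?leNgt ?ltW// !measure0 adde0.
  rewrite [nuG _]lebesgue_stieltjes_oc// [nuC _]lebesgue_stieltjes_oc//.
  rewrite [LHS]lebesgue_stieltjes_oc// -EFinD /= /C.
  by congr EFin; ring.
have le A : measurable A -> (nuG A <= mu A)%E.
  by move=> mA; rewrite muE// leeDl.
pose D := `]0, T]%classic.
have mD : measurable (D : set (measurableTypeR R)) by exact: measurable_itv.
have DT : (nuG D < +oo)%E.
  rewrite (le_lt_trans (le _ mD))// lebesgue_measure_itv/=; case: ifP => // _.
  by rewrite -EFinB ltry.
pose nu : {finite_measure set (measurableTypeR R) -> \bar R} := mfrestr mD DT.
have numu : charge_of_finite_measure nu `<< mu.
  move=> N /= h A mA AN; apply/eqP; rewrite eq_le; apply/andP; split; last exact: measure_ge0.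
  rewrite /charge_of_finite_measure /= /mfrestr /mrestr.
  rewrite -(h A mA AN) (le_trans (le _ _))//; first exact: measurableI.
  by rewrite le_measure// ?inE//; exact: measurableI.
pose r := fine \o Radon_Nikodym (charge_of_finite_measure nu) mu.
have rE : EFin \o r = Radon_Nikodym (charge_of_finite_measure nu) mu.
  by apply/funext => x; rewrite /= fineK// Radon_Nikodym_fin_num.
exists r; rewrite rE; split; first exact: Radon_Nikodym_integrable.
move=> a b a0 ab bT; rewrite /Rintegral.
under eq_integral do rewrite -[(r _)%:E]/((EFin \o r) _) rE.
rewrite -(Radon_Nikodym_integral numu); last exact: measurable_itv.
rewrite /charge_of_finite_measure /= /mfrestr /mrestr.
rewrite setIidl; last by apply: subset_itv; rewrite bnd_simp.
by rewrite [nuG _]lebesgue_stieltjes_oc.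
Unshelve. all: by end_near. Qed.

End monotone_density.

Section primitive.
Context {R : realType}.
Notation mu := (@lebesgue_measure R).
Implicit Types (Omega : set R) (phi g : R -> R).

Lemma Cc_itv Omega psi : Cc Omega psi -> exists M, forall x, M <= `|x| -> psi x = 0.
Proof.
move=> [_ [K [/compact_bounded[M [_ Mb]] _ K0]]].
exists (`|M| + 2) => x xM; apply: K0 => Kx.
have : M < `|M| + 1 by rewrite ltr_pwDr// ler_norm.
move=> /Mb /(_ _ Kx) /=; rewrite leNgt => /negP; apply.
by apply: lt_le_trans xM; rewrite ltrD2l ltr1n.
Qed.

Lemma Cc_integrable Omega psi D : Cc Omega psi -> measurable D ->
  mu.-integrable D (EFin \o psi).
Proof.
move=> cpsi mD.
have [c [K [cK _ K0]]] := cpsi.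
have cT : Cc setT psi by split => //; exists K; split.
have lT : locally_integrable setT (cst (1 : R)).
  by rewrite -(indicT R); apply: locally_integrable_indic; [exact: openT|exact: measurableT].
have := locally_integrable_Cc lT cT.
rewrite [X in EFin \o X](_ : _ = psi); last by apply/funext => x; rewrite mul1r.
by apply: integrableS => //; exact: mD.
Qed.

(** Fundamental theorem of calculus on [`[s, b]] for any [b] to the right of the
    support of [phi]. *)
Lemma integral_test_derive_tail Omega phi s : Cc_infty Omega phi ->
  \int[mu]_(t in `[s, +oo[) derive1 phi t = - phi s.
Proof.
move=> Cphi; have [M M0] := Cc_itv (Cc_infty_Cc Cphi).
have [M' M'0] := Cc_itv (Cc_infty_derive Cphi).
pose b := `|s| + `|M| + `|M'| + 1.
have sb : s < b by rewrite /b; have := ler_norm s; have := normr_ge0 M; have := normr_ge0 M'; lra.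
have b0 : 0 <= b by rewrite /b !addr_ge0.
have Mb : M <= b by rewrite /b; have := ler_norm M; have := normr_ge0 s; have := normr_ge0 M'; lra.
have M'b : M' <= b by rewrite /b; have := ler_norm M'; have := normr_ge0 s; have := normr_ge0 M; lra.
have cphi : continuous phi by have [] := Cc_infty_Cc Cphi.
have cdphi : continuous (derive1 phi) by have [] := Cc_infty_derive Cphi.
transitivity (\int[mu]_(t in `[s, b]) derive1 phi t).
  rewrite Rintegral_mkcond [RHS]Rintegral_mkcond; apply: eq_Rintegral => t _.
  rewrite !patchE !mem_setE !in_itv/= andbT; case: leP => //= st; case: leP => // bt.
  by rewrite M'0// (le_trans M'b)// (le_trans (ltW bt)) ?ler_norm.
rewrite /Rintegral (@continuous_FTC2 _ _ phi)//=.
- by rewrite (M0 b) ?sub0r// ger0_norm.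
- exact: continuous_subspaceT.
- split; first by move=> x _; exact: (Cphi.1 0).
    by apply: cvg_at_right_filter; exact: cphi.
  by apply: cvg_at_left_filter; exact: cphi.
Qed.

Lemma integral_test_derive Omega phi : Cc_infty Omega phi ->
  \int[mu]_t derive1 phi t = 0.
Proof.
move=> Cphi; have [M M0] := Cc_itv (Cc_infty_Cc Cphi).
have [M' M'0] := Cc_itv (Cc_infty_derive Cphi).
pose b := - (`|M| + `|M'|).
have b0 : b <= 0 by rewrite /b oppr_le0 addr_ge0.
transitivity (\int[mu]_(t in `[b, +oo[) derive1 phi t); last first.
  rewrite (integral_test_derive_tail _ Cphi) M0 ?oppr0// ler0_norm// /b opprK.
  by rewrite (le_trans (ler_norm _))// lerDl.
rewrite [RHS]Rintegral_mkcond; apply: eq_Rintegral => t _.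
rewrite !patchE !mem_setE !in_itv/= andbT; case: leP => //= tb.
rewrite M'0// ler0_norm; last by apply: le_trans b0; exact: ltW.
rewrite lerNr (le_trans (ltW tb))// /b lerN2 (le_trans (ler_norm _))// lerDr//.
Qed.

(** Integration by parts against a test function, by exchanging the order of
    integration over the region [s <= t] of the plane. *)
Lemma integral_primitive_test Omega g phi : mu.-integrable setT (EFin \o g) ->
  Cc_infty Omega phi ->
  \int[mu]_t ((\int[mu]_(s in `]-oo, t]) g s) * derive1 phi t) =
  - \int[mu]_t (g t * phi t).
Proof.
move=> ig Cphi.
have mg : measurable_fun setT g by apply/measurable_EFinP; exact: measurable_int ig.
have Cd := Cc_infty_derive Cphi.
have md : measurable_fun setT (derive1 phi) by exact: Cc_measurable Cd.
have idphi := Cc_integrable Cd measurableT.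
pose f (z : R * R) : \bar R := (if z.2 <= z.1 then derive1 phi z.1 * g z.2 else 0)%:E.
have mf : measurable_fun setT (f : measurableTypeR R * measurableTypeR R -> \bar R).
  apply/measurable_EFinP; apply: measurable_fun_ifT.
  - exact: (measurable_fun_ler measurable_snd measurable_fst).
  - apply: measurable_funM; first exact: (measurableT_comp md measurable_fst).
    exact: (measurableT_comp mg measurable_snd).
  - exact: measurable_cst.
have intf : (mu \x mu)%E.-integrable setT f.
  apply/integrable12ltyP => //.
  pose c := fine (\int[mu]_y `|g y|%:E)%E.
  have cE : (\int[mu]_y `|g y|%:E)%E = c%:E.
    rewrite fineK//; apply: integrable_fin_num; first exact: measurableT.
    exact: integrable_norm ig.
  have /integrableP[_] := integrableZl measurableT c idphi.
  apply: le_lt_trans; apply: ge0_le_integral => //.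
  - by move=> x _; exact: integral_ge0.
  - refine (@measurable_fun_fubini_tonelli_F _ _ (measurableTypeR R)
      (measurableTypeR R) R mu (abse \o f) _ _); last by move=> z; exact: abse_ge0.
    exact: measurableT_comp.
  - by apply: measurableT_comp => //; apply/measurable_EFinP; exact: measurable_funM.
  move=> x _.
  have c0 : 0 <= c by rewrite fine_ge0// integral_ge0.
  rewrite /= normrM (ger0_norm c0) mulrC EFinM -cE -ge0_integralZl//; last first.
    by apply/measurable_EFinP; exact: measurableT_comp.
  apply: ge0_le_integral => //.
  - apply/measurable_EFinP; apply: measurableT_comp => //; apply: measurable_fun_ifT => //.
      exact: measurable_fun_ler.
    exact: measurable_funM.
  - by apply/measurable_EFinP; apply: measurable_funM => //; exact: measurableT_comp.
  - move=> y _; rewrite /f /= lee_fin; case: ifP => _; first by rewrite normrM.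
    by rewrite normr0 mulr_ge0.
have := Fubini intf.
have -> : (fun x => \int[mu]_y f (x, y))%E =
    (fun x => ((\int[mu]_(s in `]-oo, x]) g s) * derive1 phi x)%:E).
  apply/funext => x.
  have igx : mu.-integrable `]-oo, x] (EFin \o g).
    by apply: integrableS ig => //; exact: measurable_itv.
  rewrite mulrC -RintegralZl; [|exact: measurable_itv|exact: igx].
  rewrite fineK; last first.
    apply: integrable_fin_num; first exact: measurable_itv.
    by apply: integrableZl igx; exact: measurable_itv.
  rewrite [RHS]integral_mkcond; apply: eq_integral => y _.
  by rewrite /f patchE mem_setE in_itv/=; case: ifP.
have -> : (fun y => \int[mu]_x f (x, y))%E = (fun y => (- (g y * phi y))%:E).
  apply/funext => y.
  have idy : mu.-integrable `[y, +oo[ (EFin \o derive1 phi).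
    by apply: Cc_integrable Cd _; exact: measurable_itv.
  rewrite -mulrN -(integral_test_derive_tail y Cphi) -RintegralZl; [|exact: measurable_itv|exact: idy].
  rewrite fineK; last first.
    apply: integrable_fin_num; first exact: measurable_itv.
    by apply: integrableZl idy; exact: measurable_itv.
  rewrite [RHS]integral_mkcond; apply: eq_integral => x _.
  by rewrite /f patchE mem_setE in_itv/= andbT mulrC; case: ifP.
move=> E; rewrite [LHS]/Rintegral E.
have igp : mu.-integrable setT (EFin \o (fun t => g t * phi t)).
  have [M Mb] := Cc_bounded (Cc_infty_Cc Cphi).
  apply: (@integrableMl _ _ _ mu setT measurableT (EFin \o g) phi ig).
    exact: Cc_measurable (Cc_infty_Cc Cphi).
  exists M; split; first exact: num_real.
  by move=> z Mz x _; rewrite /= (le_trans (Mb x))// ltW.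
rewrite -mulN1r -RintegralZl//; congr fine; apply: eq_integral => x _.
by rewrite mulN1r.
Qed.

End primitive.

Section lipschitz.
Context {R : realType}.
Notation mu := (@lebesgue_measure R).

Lemma max_nonexpansive (c x y : R) : `|Num.max c x - Num.max c y| <= `|x - y|.
Proof.
have [?|?] := ger0P (x - y); rewrite ler_norml;
  by case: (leP c x) => ?; case: (leP c y) => ?; lra.
Qed.

Lemma min_nonexpansive (c x y : R) : `|Num.min x c - Num.min y c| <= `|x - y|.
Proof.
have [?|?] := ger0P (x - y); rewrite ler_norml;
  by case: (leP x c) => ?; case: (leP y c) => ?; lra.
Qed.

Lemma derive1_lipschitz (F : R -> R) (L x : R) : derivable F x 1 ->
  (forall y z, `|F y - F z| <= L * `|y - z|) -> `|derive1 F x| <= L.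
Proof.
move=> dF lF.
have cl : closed [set y : R | `|y| <= L].
  exact: ((continuous_closedP (@Num.norm R R)).1 (@norm_continuous R R) _ (@closed_le R L)).
rewrite derive1E /derive.
apply: (@closed_cvg _ _ _ _ _ _ cl _ _ dF).
near=> y; rewrite /= -[_ *: _]/(_ * _) normrM normfV.
have y0 : y != 0 by near: y; exact: nbhs_dnbhs_neq.
rewrite mulrC ler_pdivrMr ?normr_gt0// (le_trans (lF _ _))// addrK.
by rewrite -[_ *: _]/(_ * _) mulr1.
Unshelve. all: by end_near. Qed.

(** With [K > L], the function [(h t / K + t) / 2] is nondecreasing with
    increments at most those of the identity, so that it has a density, and
    hence so has [h]. This density is bounded by [L] because, by Lebesgue's
    differentiation theorem, it is almost everywhere the derivative of [h]. *)
Lemma lipschitz_primitive (h : R -> R) (L T : R) : 0 <= L -> 0 < T ->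
  (forall s t, 0 <= s -> 0 <= t -> `|h s - h t| <= L * `|s - t|) ->
  (forall t, T <= t -> h t = h T) ->
  exists g : R -> R, [/\ mu.-integrable setT (EFin \o g),
    forall t, t \notin `]0, T] -> g t = 0,
    forall t, `|g t| <= L &
    forall t, 0 <= t -> h t = h 0 + \int[mu]_(s in `]-oo, t]) g s].
Proof.
move=> L0 T0 hL hT.
(* L itself may be zero *)
pose K := L + 1; have K0 : 0 < K by rewrite /K; lra.
pose H t := h (Num.max 0 t).
have HL x y : `|H x - H y| <= L * `|x - y|.
  rewrite (le_trans (hL _ _ _ _)) ?le_max ?lexx// ler_wpM2l//.
  exact: max_nonexpansive.
pose G t := (H t / K + t) / 2.
have HK x y : x <= y -> `|H y / K - H x / K| <= y - x.
  move=> xy; rewrite -mulrBl normrM normfV (gtr0_norm K0) ler_pdivrMr//.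
  by rewrite (le_trans (HL _ _))// ger0_norm ?subr_ge0// mulrC ler_wpM2l ?subr_ge0// /K lerDl.
have [||r [ir rE]] := @slow_monotone_density R G T.
- by move=> x y xy; have := HK _ _ xy; rewrite ler_norml /G; lra.
- by move=> x y xy; have := HK _ _ xy; rewrite ler_norml /G; lra.
pose g := (fun t => 2 * K * r t - K) \_ `]0, T].
have i0 : mu.-integrable `]0, T] (EFin \o (fun t => 2 * K * r t - K)).
  have irT : mu.-integrable `]0, T] (EFin \o r).
    by apply: integrableS ir => //; exact: measurable_itv.
  have ic : mu.-integrable `[0, T] (EFin \o cst K).
    by apply: continuous_compact_integrable; [exact: segment_compact|exact/continuous_subspaceT/cst_continuous].
  have ic' : mu.-integrable `]0, T] (EFin \o cst K).
    by apply: integrableS ic; [exact: measurable_itv..|exact: subset_itv_oc_cc].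
  exact: integrable_sub (measurable_itv _) (integrable_Zl _ (measurable_itv _) irT) ic'.
have ig : mu.-integrable setT (EFin \o g).
  by rewrite /g -restrict_EFin; apply: (iffLR (integrable_mkcond _ _)) i0; exact: measurable_itv.
have gout t : t \notin `]0, T] -> g t = 0.
  by move=> tT; rewrite /g patchE ifN// mem_setE.
have gE t : \int[mu]_(s in `]-oo, t]) g s = H (Num.min t T) - h 0.
  rewrite -Rintegral_mkcondr.
  have -> : `]-oo, t]%classic `&` `]0, T]%classic = `]0, Num.min t T]%classic.
    apply/seteqP; split => x /=; rewrite !in_itv/= le_min.
      by move=> [-> /andP[-> ->]].
    by move=> /and3P[-> -> ->].
  have [m0|m0] := leP (Num.min t T) 0.
    by rewrite set_itv_ge ?bnd_simp -?leNgt// Rintegral_set0 /H max_l// subrr.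
  have mT : Num.min t T <= T by rewrite ge_min lexx orbT.
  have iS (k : R -> R) : mu.-integrable `]0, T] (EFin \o k) ->
      mu.-integrable `]0, Num.min t T] (EFin \o k).
    by apply: integrableS; [exact: measurable_itv..|apply: subset_itvl; rewrite bnd_simp].
  have irm : mu.-integrable `]0, Num.min t T] (EFin \o r).
    by apply: integrableS ir => //; exact: measurable_itv.
  have icm : mu.-integrable `]0, Num.min t T] (EFin \o cst K).
    have -> : cst K = (fun t => 2 * K * r t - (2 * K * r t - K)).
      by apply/funext => s; rewrite opprB addrC subrK.
    exact: integrable_sub (measurable_itv _) (integrable_Zl _ (measurable_itv _) irm) (iS _ i0).
  rewrite RintegralB//; last by apply: integrable_Zl irm; exact: measurable_itv.
  rewrite RintegralZl// -rE// ?ltW// Rintegral_cst//.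
  rewrite /= lebesgue_measure_itv/= lte_fin m0 -EFinB subr0 /=.
  rewrite /G {2}/H max_l//.
  have := K0; move: (Num.min t T) (h 0) (H _) => a b c0 K0'.
  by field; rewrite gt_eqF.
have gL : {ae mu, forall t, `|g t| <= L}.
  have iy (y : R) : mu.-integrable `]-oo, y] (EFin \o g).
    by apply: integrableS ig => //; exact: measurable_itv.
  have lg : locally_integrable setT g by apply: open_integrable_locally => //; exact: openT.
  have := FTC1Ny iy lg; apply: ae_imply => x [dx <-].
  apply: derive1_lipschitz => // y z; rewrite !gE opprB addrA subrK.
  rewrite (le_trans (HL _ _))// ler_wpM2l//.
  exact: min_nonexpansive.
(* truncating g on a null set makes the bound hold everywhere *)
pose gt t := Num.max (- L) (Num.min L (g t)).
have gtg : {ae mu, forall t, gt t = g t}.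
  by apply: ae_imply gL => t; rewrite ler_norml /gt => /andP[g1 g2]; rewrite min_r// max_r.
have mg : measurable_fun setT g by apply/measurable_EFinP; exact: measurable_int ig.
have mgt : measurable_fun setT gt.
  by apply: measurable_maxr => //; exact: measurable_minr.
exists gt; split.
- apply: (@ae_eq_integrable _ setT gt g) => //.
  by apply: ae_imply gtg.
- by move=> t /gout gt0; rewrite /gt gt0 min_r// max_r// oppr_le0.
- by move=> t; rewrite ler_norml /gt le_max lexx/= ge_max ge_min lexx/= andbT ge0_cp.
- move=> t t0.
  rewrite (@ae_eq_Rintegral _ _ gt g); last 4 first.
  + exact: measurable_itv.
  + exact: measurable_funTS.
  + exact: measurable_funTS.
  + by apply: ae_imply gtg.
  rewrite gE /H addrC subrK.
  case: (leP t T) => tT; first by rewrite max_r.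
  by rewrite max_r ?ltW// hT// ltW.
Qed.

End lipschitz.

(** * Weak derivatives *)

Section weak_derivative.
Context {R : realType}.
Notation mu := (@lebesgue_measure R).
Implicit Types (Omega U : set R).

Lemma ae_forall_ord n (P : 'I_n -> R -> Prop) :
  (forall i, {ae mu, forall t, P i t}) -> {ae mu, forall t, forall i, P i t}.
Proof.
move=> h; have : {ae mu, forall t, forall k : nat, forall i : 'I_n, i = k :> nat -> P i t}.
  apply: ae_foralln => k; have [kn|nk] := ltnP k n.
    apply: ae_imply (h (Ordinal kn)) => t Pt i ik.
    by rewrite (_ : i = Ordinal kn)//; exact: val_inj.
  by apply: aeW => t i ik; move: (ltn_ord i); rewrite ik ltnNge nk.
by apply: ae_imply => t Pt i; exact: (Pt i).
Qed.

Lemma locally_integrable_restrict Omega U (w : R -> R) : U `<=` Omega -> open U ->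
  locally_integrable Omega w -> locally_integrable U w.
Proof.
move=> UO oU [mw oO iw]; split => //.
  by apply: measurable_funS mw => //; exact: open_measurable.
by move=> K KU; apply: iw; exact: subset_trans UO.
Qed.

Lemma Cc_infty_sub Omega U phi : U `<=` Omega -> Cc_infty U phi -> Cc_infty Omega phi.
Proof. by move=> UO [d [K [cK KU K0]]]; split=> //; exists K; split => //; exact: subset_trans UO. Qed.

Lemma Rintegral_Cc_sub Omega U (w psi : R -> R) : U `<=` Omega -> Cc U psi ->
  \int[mu]_(t in Omega) (w t * psi t) = \int[mu]_(t in U) (w t * psi t).
Proof.
move=> UO [_ [K [_ KU K0]]].
rewrite Rintegral_mkcond [RHS]Rintegral_mkcond; apply: eq_Rintegral => t _.
rewrite !patchE; case: ifPn => tO; case: ifPn => // tU.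
  by rewrite K0 ?mulr0// => /KU /mem_set; apply/negP.
by case/negP: tO; apply: mem_set; apply: UO; exact: set_mem.
Qed.

Context {n : nat}.
Implicit Types v g : R -> 'rV[R]_n.

Lemma is_weak_derivative_sub Omega U v g : U `<=` Omega -> open U ->
  is_weak_derivative Omega v g -> is_weak_derivative U v g.
Proof.
move=> UO oU wd i; have [lv lg vg] := wd i; split.
- exact: locally_integrable_restrict lv.
- exact: locally_integrable_restrict lg.
move=> phi Cphi; rewrite -(Rintegral_Cc_sub _ UO (Cc_infty_derive Cphi)).
by rewrite -(Rintegral_Cc_sub _ UO (Cc_infty_Cc Cphi)) vg//; exact: Cc_infty_sub Cphi.
Qed.

Lemma Rintegral_locally_integrable_ae Omega (w1 w2 psi : R -> R) :
  locally_integrable Omega w1 -> locally_integrable Omega w2 -> Cc Omega psi ->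
  {ae mu, forall t, Omega t -> w1 t = w2 t} ->
  \int[mu]_(t in Omega) (w1 t * psi t) = \int[mu]_(t in Omega) (w2 t * psi t).
Proof.
move=> [m1 oO _] [m2 _ _] Cpsi w12.
have mpsi := Cc_measurable (D := Omega) Cpsi.
apply: ae_eq_Rintegral; [exact: open_measurable|exact: measurable_funM..|].
by apply: ae_imply w12 => t h Ot; rewrite h.
Qed.

(** Stated for two functions equal almost everywhere, so that weak derivatives
    are attached to classes of functions. *)
Lemma weak_derivative_unique Omega v1 v2 g1 g2 :
  is_weak_derivative Omega v1 g1 -> is_weak_derivative Omega v2 g2 ->
  {ae mu, forall t, Omega t -> v1 t = v2 t} ->
  {ae mu, forall t, Omega t -> g1 t = g2 t}.
Proof.
move=> wd1 wd2 v12.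
suff : {ae mu, forall t, forall i : 'I_n, Omega t -> g1 t 0 i - g2 t 0 i = 0}.
  apply: ae_imply => t h Ot; apply/rowP => i; apply/eqP.
  by rewrite -subr_eq0; apply/eqP; exact: h.
apply: ae_forall_ord => i.
have [lv1 lg1 vg1] := wd1 i; have [lv2 lg2 vg2] := wd2 i.
apply: (du_bois_reymond (w := fun t => g1 t 0 i - g2 t 0 i)).
  exact: locally_integrableB.
move=> phi Cphi; have C := Cc_infty_Cc Cphi.
under eq_Rintegral do rewrite mulrBl.
have [_ /open_measurable mO _] := lg1.
rewrite RintegralB//; [|exact: locally_integrable_Cc lg1 C|exact: locally_integrable_Cc lg2 C].
apply/eqP; rewrite subr_eq0 -eqr_opp -vg1// -vg2//; apply/eqP.
apply: Rintegral_locally_integrable_ae => //; first exact: Cc_infty_derive.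
by apply: ae_imply v12 => t h Ot; rewrite h.
Qed.

Lemma is_weak_derivative_lin Omega a v1 v2 g1 g2 :
  is_weak_derivative Omega v1 g1 -> is_weak_derivative Omega v2 g2 ->
  is_weak_derivative Omega (a *: v1 + v2) (a *: g1 + g2).
Proof.
have lin (w1 w2 : R -> 'rV[R]_n) i : locally_integrable Omega (fun t => w1 t 0 i) ->
    locally_integrable Omega (fun t => w2 t 0 i) ->
    locally_integrable Omega (fun t => (a *: w1 + w2) t 0 i).
  move=> l1 l2.
  rewrite (_ : (fun _ => _) = (fun t => a * w1 t 0 i) \+ (fun t => w2 t 0 i)); last first.
    by apply/funext => t; rewrite !mxE.
  apply: locally_integrableD => //.
  have [m1 oO _] := l1; split => //; first exact: measurable_funM.
  move=> K KO cK; have := integrable_Zl a (compact_measurable cK) (locally_integrable_integrable l1 KO cK).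
  by case/integrableP.
have int (w1 w2 : R -> 'rV[R]_n) i psi : locally_integrable Omega (fun t => w1 t 0 i) ->
    locally_integrable Omega (fun t => w2 t 0 i) -> Cc Omega psi ->
    \int[mu]_(t in Omega) ((a *: w1 + w2) t 0 i * psi t) =
    a * \int[mu]_(t in Omega) (w1 t 0 i * psi t) + \int[mu]_(t in Omega) (w2 t 0 i * psi t).
  move=> l1 l2 Cpsi.
  have [_ /open_measurable mO _] := l1.
  have i1 := locally_integrable_Cc l1 Cpsi; have i2 := locally_integrable_Cc l2 Cpsi.
  rewrite -RintegralZl// -RintegralD//; last exact: integrable_Zl.
  by apply: eq_Rintegral => t _; rewrite !mxE mulrDl mulrA.
move=> wd1 wd2 i; have [lv1 lg1 vg1] := wd1 i; have [lv2 lg2 vg2] := wd2 i.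
split; [exact: lin..|] => phi Cphi.
rewrite int//; last exact: Cc_infty_derive.
rewrite int//; last exact: Cc_infty_Cc.
by rewrite vg1// vg2// mulrN opprD.
Qed.

Lemma weak_derivativeP Omega v g : is_weak_derivative Omega v g ->
  is_weak_derivative Omega v (weak_derivative Omega v).
Proof.
by move=> wd; rewrite /weak_derivative; case: xgetP => [y _ //|/(_ g)].
Qed.

End weak_derivative.

Section half_line.
Context {R : realType}.
Notation mu := (@lebesgue_measure R).

Lemma itv_sub_half_line (T : R) : `]0, T[%classic `<=` `]0, +oo[%classic.
Proof. by move=> x /=; rewrite !in_itv/= => /andP[->]. Qed.

Lemma compact_half_line (K : set R) : compact K -> K `<=` `]0, +oo[ ->
  exists N : nat, K `<=` `]0, N.+1%:R[.
Proof.
move=> /compact_bounded[M [_ Mb]] K0.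
exists (Num.truncn (`|M| + 1)) => x Kx; have := K0 _ Kx.
rewrite /= !in_itv/= andbT => -> /=.
apply: le_lt_trans (truncnS_gt _); apply: le_trans (ler_norm x) _.
by apply: (Mb _ _ _ Kx); rewrite ltr_pwDr// ler_norm.
Qed.

Lemma measurable_half_line (w : R -> R) :
  (forall N : nat, measurable_fun (`]0, N.+1%:R[%classic : set R) w) ->
  measurable_fun (`]0, +oo[%classic : set R) w.
Proof.
move=> mw.
have -> : `]0, +oo[%classic = \bigcup_N `]0, N.+1%:R[%classic :> set R.
  apply/seteqP; split=> x /=; last by move=> [N _]; exact: itv_sub_half_line.
  rewrite in_itv/= andbT => x0; exists (Num.truncn x) => //=.
  by rewrite in_itv/= x0 truncnS_gt.
by apply/measurable_fun_bigcup => // N; exact: mw.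
Qed.

Lemma locally_integrable_half_line (w : R -> R) :
  (forall N : nat, mu.-integrable `]0, N.+1%:R[ (EFin \o w)) ->
  locally_integrable `]0, +oo[ w.
Proof.
move=> iw; split; first by apply: measurable_half_line => N;
  apply/measurable_EFinP; exact: measurable_int (iw N).
  exact: interval_open.
move=> K K0 cK; have [N KN] := compact_half_line cK K0.
have mK := compact_measurable cK.
have /integrableP[_] : mu.-integrable K (EFin \o w); last by [].
by apply: integrableS (iw N) => //; exact: measurable_itv.
Qed.

Lemma Cc_infty_half_line phi : Cc_infty `]0, +oo[%classic phi ->
  exists N : nat, Cc_infty (`]0, N.+1%:R[%classic : set R) phi.
Proof.
move=> [d [K [cK K0 Kphi]]]; have [N KN] := compact_half_line cK K0.
by exists N; split => //; exists K.
Qed.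

Context {n : nat}.
Implicit Types v g : R -> 'rV[R]_n.

(** Weak derivatives on the intervals [`]0, N + 1[] agree almost everywhere on
    overlaps by uniqueness, so that they glue. *)
Lemma W11loc_weak_derivative v : W11loc v ->
  exists v', is_weak_derivative `]0, +oo[ v v' /\ forall T, 0 < T -> L1 `]0, T[ v'.
Proof.
move=> Wv.
have [g gP] := choice (fun N : nat => (Wv N.+1%:R (ltr0Sn _ _)).2).
(* t belongs to the interval of index truncn t; measurability of the glued
   function is proved piecewise since Lebesgue measure on Borel sets is not
   complete *)
pose v' t := g (Num.truncn t) t.
have agree : {ae mu, forall t, forall N : nat, 0 < t -> t < N.+1%:R -> v' t = g N t}.
  have ov N M : {ae mu, forall t, `]0, (minn N M).+1%:R[%classic t -> g N t = g M t}.
    have sub P Q : (P <= Q)%N -> `]0, P.+1%:R[%classic `<=` (`]0, Q.+1%:R[%classic : set R).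
      by move=> PQ; apply: subset_itvl; rewrite bnd_simp ler_nat.
    apply: (weak_derivative_unique (v1 := v) (v2 := v)); last exact: aeW.
      apply: is_weak_derivative_sub (gP N).1; last exact: interval_open.
      by apply: sub; exact: geq_minl.
    apply: is_weak_derivative_sub (gP M).1; last exact: interval_open.
    by apply: sub; exact: geq_minr.
  have : {ae mu, forall t, forall N M, `]0, (minn N M).+1%:R[%classic t -> g N t = g M t}.
    by apply: ae_foralln => N; apply: ae_foralln => M; exact: ov.
  apply: ae_imply => t h N t0 tN; apply: h => /=; rewrite in_itv/= t0 /=.
  by rewrite /minn; case: ifP => _ //; exact: truncnS_gt.
have agreeN N : {ae mu, forall t, `]0, N.+1%:R[%classic t -> v' t = g N t}.
  by apply: ae_imply agree => t h /=; rewrite in_itv/= => /andP[t0 tN]; exact: h.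
have mv' i : measurable_fun (`]0, +oo[%classic : set R) (fun t => v' t 0 i).
  have -> : `]0, +oo[%classic =
      \bigcup_N (`]0, +oo[%classic `&` `[N%:R, N.+1%:R[%classic) :> set R.
    apply/seteqP; split=> x /=; last by move=> [N _ []].
    rewrite in_itv/= andbT => x0; exists (Num.truncn x) => //=.
    split; first by rewrite in_itv/= x0.
    by rewrite in_itv/= truncnS_gt andbT truncn_le// ltW.
  apply/measurable_fun_bigcup => N; first exact: measurableI.
  apply: (eq_measurable_fun (fun t => g N t 0 i)).
    move=> x /set_mem /= [_]; rewrite in_itv/= => xN.
    by rewrite /v' (_ : Num.truncn x = N)//; apply/eqP; rewrite truncn_eq// (le_trans _ (andP xN).1).
  have [_ [mg _ _] _] := (gP N).1 i.
  apply: measurable_funS mg => // x /= [+ +]; rewrite !in_itv/= => /andP[-> _] /andP[_ ->].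
  by [].
have iv' N : L1 `]0, N.+1%:R[ v'.
  move=> i; apply: (@ae_eq_integrable _ `]0, N.+1%:R[%classic _ (fun t => g N t 0 i)).
  - exact: measurable_itv.
  - by apply: measurable_funS (mv' i) => //; exact: itv_sub_half_line.
  - by apply: ae_imply (agreeN N) => t h Ot; rewrite h.
  - exact: (gP N).2.
exists v'; split=> [i|T T0 i]; last first.
  apply: integrableS (iv' (Num.truncn T) i); [exact: measurable_itv..|].
  by apply: subset_itvl; rewrite bnd_simp ltW// truncnS_gt.
have lv : locally_integrable `]0, +oo[ (fun t => v t 0 i).
  by apply: locally_integrable_half_line => N; exact: (Wv _ (ltr0Sn _ _)).1.
have lv' : locally_integrable `]0, +oo[ (fun t => v' t 0 i).
  by apply: locally_integrable_half_line => N; exact: iv'.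
split => // phi Cphi; have [N CN] := Cc_infty_half_line Cphi.
rewrite (Rintegral_Cc_sub _ (@itv_sub_half_line _) (Cc_infty_derive CN)).
rewrite (Rintegral_Cc_sub _ (@itv_sub_half_line _) (Cc_infty_Cc CN)).
have [_ lg vg] := (gP N).1 i; rewrite vg//; congr (- _).
apply: Rintegral_locally_integrable_ae => //.
- by apply: locally_integrable_restrict lv'; [exact: itv_sub_half_line|exact: interval_open].
- exact: Cc_infty_Cc.
- by apply: ae_imply (agreeN N) => t h Ot; rewrite h.
Qed.

End half_line.

Section lipschitz_weak_derivative.
Context {R : realType}.
Notation mu := (@lebesgue_measure R).
Notation half := (`]0, +oo[%classic : set R).

Lemma lipschitz_half_line_locally_integrable (h : R -> R) L : 0 <= L ->
  (forall s t, 0 <= s -> 0 <= t -> `|h s - h t| <= L * `|s - t|) ->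
  locally_integrable half h.
Proof.
move=> L0 hL; apply: locally_integrable_half_line => N.
pose H t := h (Num.max 0 t).
have cH : continuous H.
  move=> x; apply/cvgrPdist_le => e e0; near=> y.
  rewrite /H (le_trans (hL _ _ _ _)) ?le_max ?lexx//.
  have xy : `|x - y| <= e / (L + 1).
    near: y; apply: (@cvgr_dist_le _ _ _ (nbhs x) _ id) => //.
    by rewrite divr_gt0// ltr_wpDl.
  have m := max_nonexpansive 0 x y.
  rewrite (le_trans (ler_wpM2l L0 (le_trans m xy)))// mulrA ler_pdivrMr ?ltr_wpDl//.
  by rewrite mulrC mulrDr mulr1 lerDl ltW.
have iH : mu.-integrable `[0, N.+1%:R] (EFin \o H).
  by apply: continuous_compact_integrable; [exact: segment_compact|exact: continuous_subspaceT].
apply: (@eq_integrable _ _ _ mu _ (measurable_itv _) (EFin \o H)).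
- by move=> x /set_mem /=; rewrite in_itv/= => /andP[x0 _]; rewrite /= /H max_r// ltW.
- by apply: integrableS iH; [exact: measurable_itv..|exact: subset_itv_oo_cc].
Unshelve. all: by end_near. Qed.

Lemma lipschitz_integration_by_parts (h : R -> R) L T : 0 <= L -> 0 < T ->
  (forall s t, 0 <= s -> 0 <= t -> `|h s - h t| <= L * `|s - t|) ->
  (forall t, T <= t -> h t = h T) ->
  exists g : R -> R, [/\ locally_integrable half g,
    forall t, t \notin `]0, T] -> g t = 0, forall t, `|g t| <= L &
    forall phi, Cc_infty half phi ->
      \int[mu]_(t in half) (h t * derive1 phi t) = - \int[mu]_(t in half) (g t * phi t)].
Proof.
move=> L0 T0 hL hT.
have [g [ig g0 gL hE]] := lipschitz_primitive L0 T0 hL hT.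
exists g; split => //.
  apply: open_integrable_locally; first exact: interval_open.
  by apply: integrableS ig => //; exact: measurable_itv.
move=> phi Cphi.
have [dphi [K [cK K0 Kphi]]] := Cphi.
have CT : Cc_infty setT phi by exact: Cc_infty_sub Cphi.
have dE := integral_primitive_test ig CT.
have -> : \int[mu]_(t in half) (g t * phi t) = \int[mu]_t (g t * phi t).
  by apply/esym; apply: Rintegral_Cc_sub => //; exact: Cc_infty_Cc Cphi.
rewrite -dE.
have lh := lipschitz_half_line_locally_integrable L0 hL.
have Cd := Cc_infty_derive Cphi.
have ih := locally_integrable_Cc lh Cd.
have idphi := Cc_integrable Cd (measurable_itv _).
have d0 : \int[mu]_(t in half) derive1 phi t = 0.
  have e : (fun t => cst (1 : R) t * derive1 phi t) = derive1 phi.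
    by apply/funext => t; rewrite mul1r.
  have := Rintegral_Cc_sub (cst 1) (@subsetT _ half) Cd.
  by rewrite e => <-; exact: integral_test_derive CT.
transitivity (\int[mu]_(t in half) (h t * derive1 phi t - h 0 * derive1 phi t)).
  rewrite RintegralB//; last exact: integrable_Zl.
  by rewrite RintegralZl// d0 mulr0 subr0.
rewrite (@Rintegral_Cc_sub _ setT half (fun t => \int[mu]_(s in `]-oo, t]) g s))//.
apply: eq_Rintegral => t /set_mem /=; rewrite in_itv/= andbT => t0.
by rewrite hE ?ltW// -mulrBl [X in X * _]addrC addKr.
Qed.

Lemma lipschitz_weak_derivative n (u : R -> 'rV[R]_n) L T : 0 <= L -> 0 < T ->
  (forall s t, 0 <= s -> 0 <= t -> enorm (u s - u t) <= L * `|s - t|) ->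
  (forall t, T <= t -> u t = u T) ->
  exists u', [/\ is_weak_derivative half u u',
    forall t i, `|u' t 0 i| <= L & forall t, t \notin `]0, T] -> u' t = 0].
Proof.
move=> L0 T0 uL uT.
have uLi i s t : 0 <= s -> 0 <= t -> `|u s 0 i - u t 0 i| <= L * `|s - t|.
  move=> s0 t0; apply: le_trans (uL _ _ s0 t0).
  by have := coord_le_enorm (u s - u t) i; rewrite !mxE.
have uTi i t : T <= t -> u t 0 i = u T 0 i by move=> /uT ->.
have [g gP] := choice (fun i : 'I_n => lipschitz_integration_by_parts L0 T0 (uLi i) (uTi i)).
exists (fun t => \row_i g i t); split.
- move=> i; have [lg _ _ hg] := gP i.
  have gE : (fun t => (\row_i g i t) 0 i) = g i by apply/funext => t; rewrite mxE.
  split; first exact: lipschitz_half_line_locally_integrable (uLi i).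
    by rewrite gE.
  by move=> phi Cphi; rewrite hg//; congr (- _); apply: eq_Rintegral => t _; rewrite mxE.
- by move=> t i; rewrite mxE; have [] := gP i.
- by move=> t tT; apply/rowP => i; rewrite !mxE; have [_ -> //] := gP i.
Qed.

End lipschitz_weak_derivative.

(** * The spectral functional *)

Section pairing.
Context {R : realType} {n : nat}.
Notation mu := (@lebesgue_measure R).
Notation half := (`]0, +oo[%classic : set R).
Implicit Types v w : R -> 'rV[R]_n.

Definition measurable_coord (D : set R) v := forall i, measurable_fun D (fun t => v t 0 i).

Lemma measurable_dot (D : set R) v w : measurable_coord D v -> measurable_coord D w ->
  measurable_fun D (fun t => dot (v t) (w t)).
Proof. by move=> mv mw; apply: measurable_sum => i; exact: measurable_funM. Qed.

Lemma measurable_enorm (D : set R) v : measurable_coord D v ->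
  measurable_fun D (fun t => enorm (v t)).
Proof.
move=> mv; apply: measurableT_comp; last exact: measurable_dot.
by apply: continuous_measurable_fun; exact: sqrt_continuous.
Qed.

Lemma measurable_spectral (D : set R) w v v' : measurable_coord D w ->
  measurable_coord D v -> measurable_coord D v' ->
  measurable_fun D (spectral_integrand w v v').
Proof.
move=> mw mv mv'; apply: measurable_dot => // i.
rewrite (_ : (fun _ => _) = (fun t => t * v' t 0 i + v t 0 i)); last first.
  by apply/funext => t; rewrite !mxE.
by apply: measurable_funD => //; apply: measurable_funM.
Qed.

Lemma L1_integrable_enorm (D : set R) v : measurable D -> L1 D v ->
  mu.-integrable D (EFin \o (fun t => enorm (v t))).
Proof.
move=> mD iv.
have isum : mu.-integrable D (fun t => \sum_(i < n) (`|v t 0 i|)%:E)%E.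
  by apply: integrable_sum => [|i _]; [exact: mD|exact: integrable_norm (iv i)].
apply: le_integrable isum; first exact: mD.
  apply/measurable_EFinP; apply: measurable_enorm => i.
  by apply/measurable_EFinP; exact: measurable_int (iv i).
move=> t _; rewrite sumEFin /= lee_fin ger0_norm ?enorm_ge0//.
by rewrite (le_trans (enorm_le_sum _))// ler_norm.
Qed.

Lemma spectral_integrand_le w v v' (L T t : R) : 0 <= L -> 0 <= T ->
  (forall i, `|w t 0 i| <= L) -> 0 <= t <= T ->
  `|spectral_integrand w v v' t| <= n%:R * L * (T + 1) * (enorm (v t) + enorm (v' t)).
Proof.
move=> L0 T0 wL /andP[t0 tT].
have e0 := enorm_ge0 (v t); have e0' := enorm_ge0 (v' t).
rewrite /spectral_integrand /dot (le_trans (ler_norm_sum _ _ _))//.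
apply: (@le_trans _ _ (\sum_(i < n) ((T + 1) * (enorm (v t) + enorm (v' t)) * L))).
  apply: ler_sum => i _; rewrite normrM ler_pM// !mxE.
  rewrite (le_trans (ler_normD _ _))// normrM (ger0_norm t0).
  have h1 := coord_le_enorm (v t) i; have h2 := coord_le_enorm (v' t) i.
  have h3 : t * `|v' t 0 i| <= T * enorm (v' t) by rewrite ler_pM.
  have h4 : 0 <= T * enorm (v t) by rewrite mulr_ge0.
  lra.
by rewrite sumr_const card_ord -mulr_natl le_eqVlt; apply/orP; left; apply/eqP; ring.
Qed.

(** The pairing only sees the interval [`]0, T[] where the derivative [w] of
    the solution path lives. *)
Lemma spectral_pairing w v v' (L T : R) : 0 <= L -> 0 <= T ->
  (forall t i, `|w t 0 i| <= L) -> (forall t, t \notin `]0, T[ -> w t = 0) ->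
  measurable_coord half w -> L1 `]0, T[ v -> L1 `]0, T[ v' ->
  mu.-integrable half (EFin \o spectral_integrand w v v') /\
  `|\int[mu]_(t in half) spectral_integrand w v v' t| <=
    n%:R * L * (T + 1) * (\int[mu]_(t in `]0, T[) enorm (v t) +
                          \int[mu]_(t in `]0, T[) enorm (v' t)).
Proof.
move=> L0 T0 wL w0 mw iv iv'.
have mI : measurable (`]0, T[%classic : set R) by exact: measurable_itv.
have sub : `]0, T[%classic `<=` half by move=> x /=; rewrite !in_itv/= => /andP[->].
have mc x : L1 `]0, T[ x -> measurable_coord `]0, T[%classic x.
  by move=> ix i; apply/measurable_EFinP; exact: measurable_int (ix i).
have ev := L1_integrable_enorm mI iv; have ev' := L1_integrable_enorm mI iv'.
pose C := n%:R * L * (T + 1).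
have ib : mu.-integrable `]0, T[ (EFin \o (fun t => C * (enorm (v t) + enorm (v' t)))).
  by apply: integrable_Zl => //; exact: integrable_add.
have sb t : `]0, T[%classic t ->
    `|spectral_integrand w v v' t| <= C * (enorm (v t) + enorm (v' t)).
  rewrite /= in_itv/= => /andP[t0 tT].
  by apply: spectral_integrand_le => //; rewrite ?ltW.
have iI : mu.-integrable `]0, T[ (EFin \o spectral_integrand w v v').
  apply: le_integrable ib; first exact: mI.
    apply/measurable_EFinP; apply: measurable_spectral; [|exact: mc..].
    by move=> i; exact: measurable_funS (mw i).
  by move=> t tI; rewrite /= lee_fin (le_trans (sb _ tI))// ler_norm.
have patchI : (spectral_integrand w v v') \_ half = (spectral_integrand w v v') \_ `]0, T[.
  apply/funext => t; rewrite !patchE; case: ifPn => th; case: ifPn => // tI.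
    rewrite mem_setE in tI; rewrite /spectral_integrand w0//.
    by rewrite -(scale0r 0) dotZr mul0r.
  by case/negP: th; apply: mem_set; apply: sub; exact: set_mem.
split.
  apply: (iffRL (integrable_mkcond _ _)); first exact: measurable_itv.
  rewrite restrict_EFin patchI -restrict_EFin.
  by apply: (iffLR (integrable_mkcond _ _)) iI; exact: mI.
rewrite Rintegral_mkcond patchI -Rintegral_mkcond.
rewrite (le_trans (le_normr_Rintegral _ iI))//.
rewrite -RintegralD// -RintegralZl//; last exact: integrable_add.
apply: le_Rintegral => //; exact: integrable_norm.
Qed.

End pairing.

Section spectral_representation.
Context {R : realType} {n : nat} (u : R -> 'rV[R]_n).
Notation mu := (@lebesgue_measure R).
Notation half := (`]0, +oo[%classic : set R).

(** Weak derivatives are only determined up to null sets, to which the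
    integrand of the pairing is insensitive. *)
Lemma spectral_integral_unique (v1 v2 u1 u2 v1' v2' : R -> 'rV[R]_n) :
  is_weak_derivative half u u1 -> is_weak_derivative half u u2 ->
  is_weak_derivative half v1 v1' -> is_weak_derivative half v2 v2' ->
  {ae mu, forall t, half t -> v1 t = v2 t} ->
  {ae mu, forall t, half t -> spectral_integrand u1 v1 v1' t = spectral_integrand u2 v2 v2' t}.
Proof.
move=> wu1 wu2 wv1 wv2 v12.
have h1 := weak_derivative_unique wu1 wu2 (aeW _ (fun x _ => erefl)).
have h2 := weak_derivative_unique wv1 wv2 v12.
apply: (ae_imply2 _ h1 (ae_imply2 (fun t a b => conj a b) h2 v12)) => t e1 [e2 e3] ht.
by rewrite /spectral_integrand e1// e2// e3.
Qed.

Lemma is_weak_derivative_measurable (v v' : R -> 'rV[R]_n) Omega :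
  is_weak_derivative Omega v v' -> measurable_coord Omega v /\ measurable_coord Omega v'.
Proof. by move=> wd; split => i; have [[? _ _] [? _ _] _] := wd i. Qed.

Lemma measurable_spectral_weak (v u' v' : R -> 'rV[R]_n) :
  is_weak_derivative half u u' -> is_weak_derivative half v v' ->
  measurable_fun half (spectral_integrand u' v v').
Proof.
move=> /is_weak_derivative_measurable[_ mu'] /is_weak_derivative_measurable[mv mv'].
exact: measurable_spectral.
Qed.

End spectral_representation.

Section W11_space.
Context {R : realType} {n : nat}.
Notation mu := (@lebesgue_measure R).
Notation half := (`]0, +oo[%classic : set R).
Implicit Types v w : R -> 'rV[R]_n.

Lemma W11loc_lin a v w : W11loc v -> W11loc w -> W11loc (a *: v + w).
Proof.
move=> Wv Ww T T0; have mI := measurable_itv `]0, T[%R.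
have lin (x y : R -> 'rV[R]_n) : L1 `]0, T[ x -> L1 `]0, T[ y -> L1 `]0, T[ (a *: x + y).
  move=> ix iy i; have := integrable_add mI (integrable_Zl a mI (ix i)) (iy i).
  by apply: eq_integrable => // t _; rewrite /= !mxE.
have [iv [v' [dv iv']]] := Wv _ T0; have [iw [w' [dw iw']]] := Ww _ T0.
split; first exact: lin.
by exists (a *: v' + w'); split; [exact: is_weak_derivative_lin|exact: lin].
Qed.

(** The weak derivative on [`]0, T[] used by the seminorm is almost everywhere
    the restriction of the one on the half-line. *)
Lemma W11_norm_weak_derivative v v' T : 0 < T -> L1 `]0, T[ v' ->
  is_weak_derivative half v v' ->
  W11_norm `]0, T[ v = \int[mu]_(t in `]0, T[) enorm (v t) +
                       \int[mu]_(t in `]0, T[) enorm (v' t).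
Proof.
move=> T0 iv' dv.
have sub : `]0, T[%classic `<=` half by move=> x /=; rewrite !in_itv/= => /andP[->].
have oI : open (`]0, T[%classic : set R) by exact: interval_open.
have dT := is_weak_derivative_sub sub oI dv.
have dT' := weak_derivativeP dT.
rewrite /W11_norm; congr (_ + _); apply: ae_eq_Rintegral.
- exact: measurable_itv.
- by apply: measurable_enorm; exact: (is_weak_derivative_measurable dT').2.
- by apply: measurable_enorm; exact: (is_weak_derivative_measurable dT).2.
have := weak_derivative_unique dT' dT (aeW _ (fun x _ => erefl)).
by apply: ae_imply => t h It; rewrite h.
Qed.

End W11_space.

(** The weak derivative of [uVM J f] enters through a representative [w] that is
    bounded and vanishes outside a bounded interval everywhere, not only almost
    everywhere. *)
Section spectral_functional.
Context {R : realType} {n : nat} (J : 'rV[R]_n -> R) (f : 'rV[R]_n).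
Notation mu := (@lebesgue_measure R).
Notation half := (`]0, +oo[%classic : set R).
Notation u := (uVM J f).
Implicit Types v w : R -> 'rV[R]_n.

Variables (w : R -> 'rV[R]_n) (L T : R).
Hypotheses (L0 : 0 <= L) (T0 : 0 < T) (dw : is_weak_derivative half u w)
  (wL : forall t i, `|w t 0 i| <= L) (w0 : forall t, t \notin `]0, T[ -> w t = 0).

Lemma phiVM_pairing v u' v' : W11loc v -> is_weak_derivative half u u' ->
  is_weak_derivative half v v' ->
  mu.-integrable half (EFin \o spectral_integrand u' v v') /\
  phiVM J f v = - \int[mu]_(t in half) spectral_integrand u' v v' t.
Proof.
move=> Wv du dv; have [v1 [dv1 iv1]] := W11loc_weak_derivative Wv.
have mh : measurable half by exact: measurable_itv.
have refl : {ae mu, forall t, half t -> v t = v t} by exact: aeW.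
split.
  have e := spectral_integral_unique du dw dv dv1 refl.
  apply: ae_eq_integrable e _ => //; first exact: measurable_spectral_weak du dv.
  have [i _] := spectral_pairing L0 (ltW T0) wL w0 (is_weak_derivative_measurable dw).2
    (Wv _ T0).1 (iv1 _ T0).
  exact: i.
have du' := weak_derivativeP du; have dv' := weak_derivativeP dv.
congr (- _); apply: ae_eq_Rintegral => //.
- exact: measurable_spectral_weak du' dv'.
- exact: measurable_spectral_weak du dv.
- exact: spectral_integral_unique du' du dv' dv refl.
Qed.

Lemma phiVM_ae v1 v2 : W11loc v1 -> W11loc v2 ->
  {ae mu, forall t, 0 < t -> v1 t = v2 t} -> phiVM J f v1 = phiVM J f v2.
Proof.
move=> W1 W2 v12; have [v1' [d1 _]] := W11loc_weak_derivative W1.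
have [v2' [d2 _]] := W11loc_weak_derivative W2.
have h12 : {ae mu, forall t, half t -> v1 t = v2 t}.
  by apply: ae_imply v12 => t h /=; rewrite in_itv/= andbT.
rewrite (phiVM_pairing W1 dw d1).2 (phiVM_pairing W2 dw d2).2.
congr (- _); apply: ae_eq_Rintegral.
- exact: measurable_itv.
- exact: measurable_spectral_weak dw d1.
- exact: measurable_spectral_weak dw d2.
- exact: spectral_integral_unique dw dw d1 d2 h12.
Qed.

Lemma phiVM_lin a v1 v2 : W11loc v1 -> W11loc v2 ->
  phiVM J f (a *: v1 + v2) = a * phiVM J f v1 + phiVM J f v2.
Proof.
move=> W1 W2; have [v1' [d1 _]] := W11loc_weak_derivative W1.
have [v2' [d2 _]] := W11loc_weak_derivative W2.
have [i1 ->] := phiVM_pairing W1 dw d1; have [i2 ->] := phiVM_pairing W2 dw d2.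
have [_ ->] := phiVM_pairing (W11loc_lin a W1 W2) dw (is_weak_derivative_lin a d1 d2).
rewrite mulrN -opprD; congr (- _).
have mh : measurable half by exact: measurable_itv.
rewrite -RintegralZl// -RintegralD//; last exact: integrable_Zl.
apply: eq_Rintegral => t _; rewrite /spectral_integrand.
rewrite -[(a *: v1' + v2') t]/(a *: v1' t + v2' t) -[(a *: v1 + v2) t]/(a *: v1 t + v2 t).
by rewrite !scalerDr !dotE; ring.
Qed.

Lemma phiVM_bounded v : W11loc v ->
  `|phiVM J f v| <= n%:R * L * (T + 1) * W11_norm `]0, T[ v.
Proof.
move=> Wv; have [v' [dv iv']] := W11loc_weak_derivative Wv.
rewrite (phiVM_pairing Wv dw dv).2 normrN (W11_norm_weak_derivative T0 (iv' _ T0) dv).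
exact: (spectral_pairing L0 (ltW T0) wL w0 (is_weak_derivative_measurable dw).2
  (Wv _ T0).1 (iv' _ T0)).2.
Qed.

Lemma phiVM_dual : W11loc_dual (phiVM J f).
Proof.
split; [exact: phiVM_ae|exact: phiVM_lin|] => v Wv.
move=> A /nbhs_ballP[e /= e0 eA].
pose C := n%:R * L * (T + 1) + 1.
have C0 : 0 < C by rewrite /C ltr_wpDl// !mulr_ge0 ?addr_ge0// ltW.
exists T, (e / C); split; [by []|exact: divr_gt0|] => x /= [Wx xv].
apply: eA; rewrite /ball /= distrC.
have Wxv : W11loc (x - v).
  by rewrite -(scaleN1r v) addrC; exact: W11loc_lin.
have -> : phiVM J f x - phiVM J f v = phiVM J f (x - v).
  by rewrite -(scaleN1r v) [x + _]addrC phiVM_lin// mulN1r addrC.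
rewrite (le_lt_trans (phiVM_bounded Wxv))//.
move: xv; rewrite ltr_pdivlMr//; apply: le_lt_trans.
rewrite mulrC ler_wpM2l// ?/C ?lerDl//.
by rewrite addr_ge0//; apply: Rintegral_ge0 => t _; exact: enorm_ge0.
Qed.

End spectral_functional.

Theorem proposition2 (R : realType) (n : nat) (J : 'rV[R]_n -> R)
    (f : 'rV[R]_n)
    (J_ge0 : forall u, 0 <= J u)
    (J_convex : convex_function [set: 'rV[R]_n] J)
    (J_lsc : lower_semicontinuous (EFin \o J))
    (J_hom : abs_one_homogeneous J) :
  (exists L : R, forall s t : R, 0 <= s -> 0 <= t ->
     enorm (uVM J f s - uVM J f t) <= L * `|s - t|) /\
  [/\ exists u' : R -> 'rV[R]_n, is_weak_derivative `]0, +oo[ (uVM J f) u',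
      forall v : R -> 'rV[R]_n, W11loc v ->
        exists v' : R -> 'rV[R]_n, is_weak_derivative `]0, +oo[ v v',
      (forall v u' v' : R -> 'rV[R]_n, W11loc v ->
         is_weak_derivative `]0, +oo[ (uVM J f) u' ->
         is_weak_derivative `]0, +oo[ v v' ->
         (@lebesgue_measure R).-integrable `]0, +oo[
           (EFin \o spectral_integrand u' v v') /\
         phiVM J f v = - \int[lebesgue_measure]_(t in `]0, +oo[)
                           spectral_integrand u' v v' t) &
      W11loc_dual (phiVM J f)].
Proof.
have [L L0 uL] := uVM_lipschitz J_ge0 J_convex J_hom f.
have [T T0 [ustar uT]] := uVM_extinction J_ge0 J_convex J_hom f.
have uT' t : T <= t -> uVM J f t = uVM J f T by move=> /uT ->; rewrite uT.
have [w [dw wL w0]] := lipschitz_weak_derivative L0 T0 uL uT'.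
have T1 : 0 < T + 1 by rewrite addr_gt0.
(* w may be nonzero at T, so that the open interval has to be enlarged *)
have w1 t : t \notin `]0, T + 1[ -> w t = 0.
  move=> tT; apply: w0; apply: contra tT; rewrite !in_itv/= => /andP[-> tT] /=.
  by rewrite (le_lt_trans tT)// ltrDl.
split; first by exists L.
split.
- by exists w.
- by move=> v /W11loc_weak_derivative[v' [dv _]]; exists v'.
- by move=> v u' v' Wv du dv; exact: (phiVM_pairing L0 T1 dw wL w1).
- exact: (phiVM_dual L0 T1 dw wL w1).
Qed.
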